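(* Fix $\kappa\in(0,1/3)$. There exist $C>0$ and an integer $L_0\ge1$ such that for all $L\ge L_0$ and all $x_0\in Q_{R_L-r_L}$, on the event $E_{L,x_0}=E_{L,x_0}(\kappa)$, $$\big|\lambda_1(Q_{R_L},\xi_L)-\bar\lambda_L-\Xi_L(x_0)\big|\le C\frac{d_L}{a_L}\Big(\Big(\frac{d_L}{a_L}\Big)^{1-2\kappa}|\xi_L(x_0)-a_L|+\frac1{a_L}\Big),$$ and $$\|\varphi_{R_L}-\bar\varphi_L(\cdot-x_0)\|_{\ell^2(Q_{R_L})}\le C\frac{d_L}{a_L}\sqrt{\Big(\frac{d_L}{a_L}\Big)^{1-2\kappa}|\xi_L(x_0)-a_L|+\frac1{a_L}},$$ where $\bar\varphi_L$ is extended by $0$ outside $Q_{r_L}$.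
   Context: Fix $d\ge1$; $|x|$ Euclidean norm; $Q_a=[-a/2,a/2]^d\cap\mathbb{Z}^d$, $Q_{a,x}=x+Q_a$, $Q_a^{\neq0}=Q_a\setminus\{0\}$; $u_L\ll v_L$ means $u_L/v_L\to0$. For each $L\ge1$, $(\xi_L(x))_{x\in\mathbb{Z}^d}$ is a centred shift-stationary Gaussian field with unit variance and non-negative covariance $v_L$ with (I) $\sup_{|x|\ge\exp(\sqrt{\ln L})}v_L(x)\ln|x|\to0$; (II) there are $\mathfrak c,\mathfrak c'>0$ with $1-e^{\mathfrak c'|x|}/d_L\le v_L(x)\le1-\mathfrak c/d_L$ for all $L,x\ne0$, where $\sup_{|x|=1}v_L(x)=1-1/d_L$. $a_L$: $\mathbb{P}(\xi_L(0)>a_L)=L^{-d}$. Fix $R_L,r_L$ with $a_L\ll\ln R_L\ll a_L^2/d_L$, $\ln a_L\le\ln r_L\ll\sqrt{a_L}$. $\Delta f(x)=\sum_{|y-x|=1}(f(y)-f(x))$; Dirichlet operators act on functions extended by $0$ outside the domain. $\lambda_1(Q_{R_L},\xi_L)$ and $\varphi_{R_L}\ge0$: principal eigenvalue and $\ell^2$-normalised eigenfunction of $\Delta+\xi_L$ on $Q_{R_L}$ (Dirichlet). $\mathcal{S}_L(x)=a_L(1-v_L(x))$; $\bar\lambda_L,\bar\varphi_L\ge0$: principal eigenvalue and normalised eigenfunction of $\Delta-\mathcal{S}_L$ on $Q_{r_L}$ (Dirichlet). $\zeta_{L,x_0}(x)=\xi_L(x)-\xi_L(x_0)v_L(x-x_0)$;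 $\Phi_L(y)=\sum_{x\in Q_{r_L}^{\neq0}}\bar\varphi_L(x)^2\zeta_{L,y}(x+y)$; $\tau_L^2=\mathrm{Var}(\Phi_L(y))$; $\Xi_L=\xi_L+\Phi_L$. Standing assumptions: $d_L\ll a_L$, $\tau_L\ll a_L^{-1}(a_L/d_L)^{1/2}$. With $\theta=2d+1$: $E_{L,x_0}(\kappa)=E^1\cap E^2\cap E^3$ with $E^1=\{|\xi_L(x_0)-a_L|<\theta\}$, $E^2=\{|\zeta_{L,x_0}(x)|\le\frac1{10}\mathcal{S}_L(x-x_0)\ \forall x\in Q_{2R_L,x_0}\}$, $E^3=\bigcap_{x\in Q_{R_L,x_0}\setminus\{x_0\}}\{|\zeta_{L,x_0}(x)|/\sqrt{\mathrm{Var}[\zeta_{L,x_0}(x)]}\le(a_L/d_L)^{\kappa|x-x_0|}\sqrt{1\vee(|\xi_L(x_0)-a_L|a_L)}\}$. *)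

(* Defs.v *)
From HB Require Import structures.
From mathcomp Require Import all_boot all_order all_algebra.
From mathcomp Require Import all_classical all_reals all_analysis.
Set Implicit Arguments.
Unset Strict Implicit.
Unset Printing Implicit Defensive.
Import Order.TTheory GRing.Theory Num.Theory.
Local Open Scope ring_scope.
Local Open Scope classical_set_scope.

Notation Zpt d := {ffun 'I_d -> int}.

Definition unitv (d : nat) (i : 'I_d) : Zpt d := [ffun j => ((i == j) : nat)%:Z].

Definition enorm {R : realType} (d : nat) (x : Zpt d) : R :=
  Num.sqrt (\sum_(i < d) ((x i)%:~R : R) ^+ 2).

(* x \in Q_a = [-a/2, a/2]^d \cap Z^d  (so x \in Q_{a,y} iff inbox a (x - y)). *)
Definition inbox {R : realType} (d : nat) (a : R) (x : Zpt d) : bool :=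
  [forall i, `|((x i)%:~R : R)| <= a / 2].

Definition cube (d N : nat) : seq (Zpt d) :=
  [seq [ffun i => (k i : nat)%:Z - N%:Z] | k : {ffun 'I_d -> 'I_(N.*2.+1)}].

Definition box {R : realType} (d : nat) (a : R) : seq (Zpt d) :=
  [seq x <- cube d `|Num.floor (`|a| / 2)|%N | inbox a x].

Definition lap {R : realType} (d : nat) (f : Zpt d -> R) (x : Zpt d) : R :=
  \sum_(i < d) ((f (x + unitv i) - f x) + (f (x - unitv i) - f x)).

Definition dirichlet_eigen {R : realType} (d : nat) (a : R) (V : Zpt d -> R)
    (lam : R) (f : Zpt d -> R) : Prop :=
  [/\ (forall x, ~~ inbox a x -> f x = 0),
      (exists x, f x != 0) &
      (forall x, inbox a x -> lap f x + V x * f x = lam * f x)].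

Definition principal_eigenpair {R : realType} (d : nat) (a : R) (V : Zpt d -> R)
    (lam : R) (f : Zpt d -> R) : Prop :=
  [/\ dirichlet_eigen a V lam f,
      (forall mu g, dirichlet_eigen a V mu g -> mu <= lam),
      (forall x, 0 <= f x) &
      \sum_(x <- box d a) f x ^+ 2 = 1].

Definition l2box {R : realType} (d : nat) (a : R) (f : Zpt d -> R) : R :=
  Num.sqrt (\sum_(x <- box d a) f x ^+ 2).

Definition centred_gaussian_law {R : realType} (s2 : R) (A : set R) : \bar R :=
  if s2 == 0 then ((\1_A : R -> R) 0)%:E else normal_prob 0 (Num.sqrt s2) A.

(* xi is a centred Gaussian field on Z^d with covariance E[xi x xi y] = v (x - y):
   every finite linear combination sum c_k xi(x_k) is N(0, sum c_k c_l v(x_k - x_l)). *)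
Definition gaussian_field {R : realType} {dT : measure_display}
    {T : measurableType dT} (P : probability T R) (d : nat)
    (xi : Zpt d -> T -> R) (v : Zpt d -> R) : Prop :=
  (forall x, measurable_fun setT (xi x)) /\
  (forall (s : seq (Zpt d * R)) (A : set R), measurable A ->
     P ((fun w => \sum_(p <- s) p.2 * xi p.1 w) @^-1` A) =
     centred_gaussian_law (\sum_(p <- s) \sum_(q <- s) p.2 * q.2 * v (p.1 - q.1)) A).

Definition negl {R : realType} (u w : nat -> R) : Prop :=
  (\forall L \near \oo, w L != 0) /\ ((fun L => u L / w L) @ \oo --> 0).

Definition zeta {R : realType} {T : Type} (d : nat) (xi : Zpt d -> T -> R)
    (v : Zpt d -> R) (x0 x : Zpt d) (w : T) : R :=
  xi x w - xi x0 w * v (x - x0).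

Definition Phi {R : realType} {T : Type} (d : nat) (xi : Zpt d -> T -> R)
    (v : Zpt d -> R) (r : R) (phibar : Zpt d -> R) (y : Zpt d) (w : T) : R :=
  \sum_(x <- box d r | x != 0) phibar x ^+ 2 * zeta xi v y (x + y) w.

Definition Xi {R : realType} {T : Type} (d : nat) (xi : Zpt d -> T -> R)
    (v : Zpt d -> R) (r : R) (phibar : Zpt d -> R) (y : Zpt d) (w : T) : R :=
  xi y w + Phi xi v r phibar y w.

(* The event E_{L,x0}(kappa) (for fixed L), with theta = 2d+1, S(x) = a(1 - v(x)). *)
Definition Eevent {R : realType} {dT : measure_display} {T : measurableType dT}
    (P : probability T R) (d : nat) (xi : Zpt d -> T -> R) (v : Zpt d -> R)
    (a dd RR kappa : R) (x0 : Zpt d) (w : T) : Prop :=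
  [/\ `|xi x0 w - a| < (2 * d + 1)%:R,
      (forall x, inbox (2 * RR) (x - x0) ->
         `|zeta xi v x0 x w| <= 10^-1 * (a * (1 - v (x - x0)))) &
      (forall x, inbox RR (x - x0) -> x != x0 ->
         `|zeta xi v x0 x w| / Num.sqrt (fine ('V_P[zeta xi v x0 x])%E)
           <= (a / dd) `^ (kappa * enorm (x - x0)) *
              Num.sqrt (Num.max 1 (`|xi x0 w - a| * a)))].

(* Main.v *)
(** Write [xi = xi(x0) v(. - x0) + zeta]. On the event, [xi - xi(x0)] vanishes at
[x0] and is at most [- m] on the rest of the box, with [m] of order [a / D]. A
unit vector vanishing at [x0] has energy at most [- m]; subtracting from a vector
orthogonal to the ground state [phi] the multiple of [phi] that agrees with it at
[x0] extends this bound to the orthogonal complement of [phi], while the ground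
state energy is at least [- 2 d]. This is a spectral gap of order [a / D]. Let
[rho] be the residual of the translate [psi] of [phibar] to [x0]. By the gap,
[phi - psi] has norm [O(|rho| / m)], and the eigenvalue equals its first-order
expansion up to [O(|rho|^2 / m)]; the first-order term [<rho, psi>] is [Phi] up
to [O(D / a^2)]. The same peak makes [phibar] decay like [O(D / a)^|x|], so that
[|rho|^2] is controlled by the variance bound for [zeta] near [x0], and by a mass
[O(1 / a)] for the truncation to the box of side [r >= a]. *)

Require Import Defs.
From HB Require Import structures.
From mathcomp Require Import all_boot all_order all_algebra.
From mathcomp Require Import all_classical all_reals all_analysis.
From mathcomp Require Import measurable_realfun.
From mathcomp Require Import ring lra zify.
Import Order.TTheory GRing.Theory Num.Theory.
Import numFieldNormedType.Exports.
Local Open Scope ring_scope.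
Local Open Scope classical_set_scope.

Set Implicit Arguments.
Unset Strict Implicit.
Unset Printing Implicit Defensive.

Section normal_moments.
Context {R : realType}.
Implicit Types (m s x : R).
Local Notation mu := (@lebesgue_measure R).

Lemma ge0_integral_normal_prob m s (f : measurableTypeR R -> \bar R) :
  (forall x, 0 <= f x)%E -> measurable_fun [set: R] f ->
  (\int[normal_prob m s]_x f x = \int[mu]_x (f x * (normal_pdf m s x)%:E))%E.
Proof.
move=> f0 mf; have dom := normal_prob_dominates m s.
rewrite -(Radon_Nikodym_SigmaFinite.change_of_variables dom)//.
apply: ae_eq_integral => //.
- apply: emeasurable_funM => //.
  exact: measurable_int (Radon_Nikodym_SigmaFinite.f_integrable dom).
- apply: emeasurable_funM => //; apply/measurable_EFinP.
  exact: measurable_normal_pdf.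
- apply: ae_eqe_mul2l => /=; apply: integral_ae_eq => //=.
  + exact: Radon_Nikodym_SigmaFinite.f_integrable.
  + by apply/measurable_EFinP; exact: measurable_normal_pdf.
  + by move=> E _ mE; rewrite -Radon_Nikodym_SigmaFinite.f_integral.
Qed.

Lemma is_derive_normal_pdf m s x : s != 0 ->
  is_derive x 1 (normal_pdf m s) (- ((x - m) / s ^+ 2) * normal_pdf m s x).
Proof.
move=> s0; rewrite normal_pdfE//.
have -> : (fun y : R => normal_peak s * normal_fun m s y) =
    normal_peak s \*: (expR \o ((- (s ^+ 2 *+ 2)^-1) \*: (center m ^+ 2))).
  apply/funext => y; rewrite /normal_fun !fctE/= /GRing.scale/=.
  by congr (_ * expR _); ring.
apply: is_derive_eq.
rewrite /normal_fun !fctE/= {1 2 3 4}/GRing.scale/= subr0 mulr1 expr1.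
have -> : - (s ^+ 2 *+ 2)^-1 * (x - m) ^+ 2 = - (x - m) ^+ 2 / (s ^+ 2 *+ 2).
  by ring.
by field.
Qed.

Lemma normal_pdfN s x : s != 0 -> normal_pdf 0 s (- x) = normal_pdf 0 s x.
Proof. by move=> s0; rewrite !normal_pdfE// /normal_fun !subr0 sqrrN. Qed.

Lemma mul_normal_pdf_le s x : s != 0 -> 0 < x ->
  x * normal_pdf 0 s x <= normal_peak s * (s ^+ 2 *+ 2) * x^-1.
Proof.
move=> s0 x0; have s20 : 0 < s ^+ 2 *+ 2.
  by rewrite pmulrn_lgt0// exprn_even_gt0.
rewrite normal_pdfE// mulrCA -mulrA ler_wpM2l ?normal_peak_ge0//.
rewrite /normal_fun subr0 mulNr expRN.
rewrite ler_pdivlMr// mulrAC -expr2 ler_pdivrMr ?expR_gt0//.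
have := expR_ge1Dx (x ^+ 2 / (s ^+ 2 *+ 2)).
rewrite -(ler_pM2l s20); apply: le_trans.
by rewrite mulrDr mulr1 mulrCA divff ?gt_eqF// mulr1 lerDr ltW.
Qed.

Lemma cvg_mul_normal_pdf s : s != 0 ->
  k%:R * normal_pdf 0 s k%:R @[k --> \oo] --> (0 : R).
Proof.
move=> s0; pose c := normal_peak s * (s ^+ 2 *+ 2).
apply: (squeeze_cvgr (f := cst 0) (h := fun k => c * k%:R^-1)).
- near=> k; rewrite mulr_ge0 ?normal_pdf_ge0//= mul_normal_pdf_le//.
  by rewrite ltr0n; near: k; exact: nbhs_infty_gt.
- exact: cvg_cst.
- rewrite -[X in _ --> X](mulr0 c); apply: cvgM; first exact: cvg_cst.
  apply/gtr0_cvgV0; last exact: cvgr_idn.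
  by near=> k; rewrite ltr0n; near: k; exact: nbhs_infty_gt.
Unshelve. all: by end_near. Qed.

Lemma derivable_LRcontinuous (f : R -> R) a b : (forall x, derivable f x 1) ->
  derivable_oo_LRcontinuous f a b.
Proof.
move=> df; have cf x : {for x, continuous f}.
  exact/differentiable_continuous/derivable1_diffP.
split=> [x _| |]; first exact: df.
- exact/cvg_at_right_filter/cf.
- exact/cvg_at_left_filter/cf.
Qed.

Lemma integral0n_sqr_normal_pdf s n : s != 0 -> (0 < n)%N ->
  (\int[mu]_(x in `[0%R, n%:R]) (x ^+ 2 * normal_pdf 0 s x)%:E =
   (s ^+ 2)%:E * \int[mu]_(x in `[0%R, n%:R]) (normal_pdf 0 s x)%:E -
   (s ^+ 2 * (n%:R * normal_pdf 0 s n%:R))%:E)%E.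
Proof.
move=> s0 n0; pose G := (- s ^+ 2) \*: normal_pdf 0 s.
have dG x : is_derive x 1 G (x * normal_pdf 0 s x).
  have ? := is_derive_normal_pdf 0 x s0; apply: is_derive_eq.
  by rewrite /GRing.scale/= subr0; field.
have := @integration_by_parts _ id G (cst 1) (fun x => x * normal_pdf 0 s x)
  0 n%:R.
under eq_integral do rewrite /= mulrA -expr2.
move=> ->.
- rewrite mul0r subr0.
  under [X in (_ - X)%E]eq_integral do
    rewrite /= mul1r /G /GRing.scale/= EFinM.
  rewrite integralZl//=; last first.
    by apply: integrableS (integrable_normal_pdf 0 s).
  rewrite EFinN mulNe oppeK addeC; congr (_ + _%:E)%E.
  by rewrite /G/= /GRing.scale/= mulNr mulrN mulrCA.
- by rewrite ltr0n.
- by apply: continuous_subspaceT => x; exact: cst_continuous.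
- by apply: derivable_LRcontinuous => x; exact: derivable_id.
- by move=> x _; rewrite derive1_id.
- apply: continuous_subspaceT => x.
  by apply: cvgM; [exact: cvg_id | exact: continuous_normal_pdf].
- by apply: derivable_LRcontinuous => x; exact: ex_derive.
- by move=> x _; rewrite derive1E derive_val.
Qed.

Lemma integral0y_sqr_normal_pdf s : s != 0 ->
  (\int[mu]_(x in `[0%R, +oo[) (x ^+ 2 * normal_pdf 0 s x)%:E =
   (s ^+ 2)%:E * \int[mu]_(x in `[0%R, +oo[) (normal_pdf 0 s x)%:E)%E.
Proof.
move=> s0.
have sqr_pdf_ge0 x : 0 <= x ^+ 2 * normal_pdf 0 s x.
  by rewrite mulr_ge0 ?sqr_ge0 ?normal_pdf_ge0.
have msqr_pdf : measurable_fun setT (fun x => x ^+ 2 * normal_pdf 0 s x).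
  apply: measurable_funM; first exact: exprn_measurable.
  exact: measurable_normal_pdf.
have cvg_sqr := @ge0_cvgn_integral _ mu _ sqr_pdf_ge0 msqr_pdf.
have cvg_pdf := @ge0_cvgn_integral _ mu _ (normal_pdf_ge0 0 s)
  (measurable_normal_pdf 0 s).
have cvg_boundary :
    (s ^+ 2 * (k%:R * normal_pdf 0 s k%:R))%:E @[k --> \oo] --> (0%E : \bar R).
  apply: cvg_EFin; first exact: nearW.
  rewrite -[X in cvg_to _ (nbhs X)](mulr0 (s ^+ 2)).
  by apply: cvgM; [exact: cvg_cst | exact: cvg_mul_normal_pdf].
have := cvgeB _ (cvgeZl (y := (s ^+ 2)%:E) _ cvg_pdf) cvg_boundary.
rewrite sube0 fin_num_adde_defl// => /(_ _ isT isT) cvg_by_parts.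
apply: cvg_unique cvg_sqr _ => //; apply: cvg_trans cvg_by_parts.
apply: near_eq_cvg; near=> n; rewrite integral0n_sqr_normal_pdf//.
by near: n; exact: nbhs_infty_gt.
Unshelve. all: by end_near. Qed.

Lemma integral_sqr_normal_pdf s : s != 0 ->
  (\int[mu]_x (x ^+ 2 * normal_pdf 0 s x)%:E = (s ^+ 2)%:E)%E.
Proof.
move=> s0; have cpdf := @continuous_normal_pdf _ 0 s s0.
rewrite ge0_symfun_integralT.
- rewrite -set_itvcy integral0y_sqr_normal_pdf// muleCA -[RHS]mule1.
  rewrite -(integral_normal_pdf 0 s); congr (_ * _)%E.
  rewrite set_itvcy -ge0_symfun_integralT// => x; first exact: normal_pdf_ge0.
  by rewrite /= normal_pdfN.
- by move=> x; rewrite mulr_ge0 ?sqr_ge0 ?normal_pdf_ge0.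
- by move=> x; apply: cvgM; [exact: sqr_continuous | exact: cpdf].
- by move=> x /=; rewrite normal_pdfN// sqrrN.
Qed.

Lemma ge0_integralT_oppr (f : R -> R) :
  (forall x, 0 <= f x) -> continuous f ->
  (\int[mu]_x (f (- x))%:E = \int[mu]_x (f x)%:E)%E.
Proof.
have fold (g : R -> R) : (forall x, 0 <= g x) -> continuous g ->
    (\int[mu]_x (g x)%:E = \int[mu]_(x in `[0%R, +oo[) (g x)%:E +
                           \int[mu]_(x in `[0%R, +oo[) (g (- x))%:E)%E.
  move=> g0 cg; have mg := continuous_measurable_fun cg.
  rewrite -(setUv `[0%R, +oo[%classic) ge0_integral_setU//=; last 4 first.
  - exact: measurableC.
  - by apply/measurable_EFinP; rewrite setUv.
  - by move=> x _; rewrite lee_fin.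
  - exact/disj_setPCl.
  congr (_ + _)%E; rewrite setCitvr integral_itv_bndo_bndc; last first.
    exact/measurable_EFinP/measurable_funTS.
  rewrite -{1}oppr0 ge0_integration_by_substitutionNy//.
  exact: continuous_subspaceT.
move=> f0 cf; have cfN : continuous (f \o -%R).
  by move=> x; apply: continuous_comp; [exact: opp_continuous | exact: cf].
rewrite (fold f)// (fold (f \o -%R) (fun=> f0 _) cfN) addeC.
by congr (_ + _)%E; apply: eq_integral => x _; rewrite /= opprK.
Qed.

End normal_moments.

Section gaussian_variance.
Context {R : realType} {dT : measure_display} {T : measurableType dT}.
Variables (P : probability T R) (X : T -> R) (s2 : R).
Hypotheses (mX : measurable_fun setT X) (s2_gt0 : 0 < s2).
Hypothesis lawX : forall A, measurable A ->
  P (X @^-1` A) = centred_gaussian_law s2 A.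
Local Notation mu := (@lebesgue_measure R).
Local Notation pdf := (normal_pdf 0 (Num.sqrt s2)).

Let s_neq0 : Num.sqrt s2 != 0. Proof. by rewrite gt_eqF// sqrtr_gt0. Qed.

Lemma ge0_expectation_gaussian (f : R -> R) :
  (forall x, 0 <= f x) -> measurable_fun setT f ->
  (\int[P]_w (f (X w))%:E = \int[mu]_x (f x * pdf x)%:E)%E.
Proof.
move=> f0 mf; under [RHS]eq_integral do rewrite EFinM.
rewrite -ge0_integral_normal_prob//=; last exact/measurable_EFinP.
have mX' : @measurable_fun _ _ T (measurableTypeR R) setT X by exact: mX.
pose X' : {RV P >-> measurableTypeR R} :=
  @mfun_Sub _ _ T (measurableTypeR R) X (mem_set mX').
pose f' (x : measurableTypeR R) := (f x)%:E.
rewrite -(ge0_integral_distribution X' (f := f')).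
- apply: (@eq_measure_integral _ (measurableTypeR R) _ setT) => A mA _.
  by apply: etrans (lawX mA) _; rewrite /centred_gaussian_law gt_eqF.
- exact/measurable_EFinP.
- by move=> y; rewrite lee_fin.
Qed.

Lemma gaussian_second_moment : (\int[P]_w (X w ^+ 2)%:E = s2%:E)%E.
Proof.
rewrite (@ge0_expectation_gaussian (fun x => x ^+ 2)).
- by rewrite integral_sqr_normal_pdf// sqr_sqrtr// ltW.
- by move=> x; exact: sqr_ge0.
- exact: exprn_measurable.
Qed.

Lemma gaussian_Lfun2 : X \in Lfun P 2%:E.
Proof.
rewrite inE; apply/andP; split; rewrite inE//=.
rewrite /finite_norm unlock /Lnorm poweR_lty//.
under eq_integral => t _ do
  rewrite /= powR_mulrn// -normrX ger0_norm ?sqr_ge0//.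
by rewrite gaussian_second_moment ltry.
Qed.

Lemma gaussian_mean0 : ('E_P[X] = 0)%E.
Proof.
have iX : P.-integrable setT (EFin \o X).
  apply/Lfun1_integrable; apply: Lfun_subset12 gaussian_Lfun2.
  exact: fin_num_measure.
pose pos (x : R) := Num.max x 0.
have pos0 x : 0 <= pos x by rewrite le_max lexx orbT.
have cpos : continuous pos.
  by move=> x; apply: continuous_max; [exact: cvg_id | exact: cvg_cst].
have mpos := continuous_measurable_fun cpos.
rewrite unlock integralE.
have -> : (\int[P]_w (EFin \o X)^\- w = \int[P]_w (EFin \o X)^\+ w)%E.
  transitivity (\int[P]_w (pos (- X w))%:E)%E.
    by apply: eq_integral => w _; rewrite funenegE/= -EFin_max.
  transitivity (\int[P]_w (pos (X w))%:E)%E; last first.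
    by apply: eq_integral => w _; rewrite funeposE/= -EFin_max.
  rewrite (@ge0_expectation_gaussian (pos \o -%R)) //=; last first.
    exact: measurableT_comp.
  rewrite (ge0_expectation_gaussian pos0)//.
  rewrite -(@ge0_integralT_oppr _ (fun x => pos x * pdf x)).
  - by apply: eq_integral => x _; rewrite normal_pdfN.
  - by move=> x; rewrite mulr_ge0 ?normal_pdf_ge0.
  - by move=> x; apply: cvgM; [exact: cpos | exact: continuous_normal_pdf].
by rewrite subee// integrable_pos_fin_num.
Qed.

Lemma variance_gaussian : ('V_P[X] = s2%:E)%E.
Proof.
rewrite (varianceE gaussian_Lfun2) gaussian_mean0 expe2 mule0 sube0.
by rewrite -gaussian_second_moment unlock.
Qed.

End gaussian_variance.

Section finite_sums.
Context {R : realType}.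

Lemma sum_cauchy_schwarz (I : Type) (s : seq I) (f g : I -> R) :
  (\sum_(x <- s) f x * g x) ^+ 2 <=
  (\sum_(x <- s) f x ^+ 2) * (\sum_(x <- s) g x ^+ 2).
Proof.
have : 0 <= \sum_(x <- s) \sum_(y <- s) (f x * g y - f y * g x) ^+ 2.
  by apply: sumr_ge0 => x _; apply: sumr_ge0 => y _; exact: sqr_ge0.
have -> : \sum_(x <- s) \sum_(y <- s) (f x * g y - f y * g x) ^+ 2 =
    \sum_(x <- s) \sum_(y <- s) (f x ^+ 2 * g y ^+ 2) +
    \sum_(x <- s) \sum_(y <- s) (g x ^+ 2 * f y ^+ 2) -
    2 * \sum_(x <- s) \sum_(y <- s) ((f x * g x) * (f y * g y)).
  rewrite mulr_sumr -big_split/= -sumrB; apply: eq_bigr => x _.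
  by rewrite mulr_sumr -big_split/= -sumrB; apply: eq_bigr => y _; ring.
by rewrite -!big_distrlr/= expr2; lra.
Qed.

Context {I : eqType}.
Implicit Types (s : seq I) (h : I -> R).

Lemma eq_sum_supp s s' h : uniq s -> uniq s' ->
  (forall x, x \in s -> x \notin s' -> h x = 0) ->
  (forall x, x \in s' -> x \notin s -> h x = 0) ->
  \sum_(x <- s) h x = \sum_(x <- s') h x.
Proof.
move=> us us' hs hs'.
have restrict (u v : seq I) : (forall x, x \in u -> x \notin v -> h x = 0) ->
    \sum_(x <- u) h x = \sum_(x <- [seq x <- u | x \in v]) h x.
  move=> huv; rewrite big_filter [RHS]big_mkcond/= !big_seq.
  by apply: eq_bigr => x xu; case: ifPn => // /(huv _ xu).
rewrite (restrict s s')// (restrict s' s)//; apply: perm_big.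
by apply: uniq_perm; rewrite ?filter_uniq// => x; rewrite !mem_filter andbC.
Qed.

Lemma ler_sum_supp s s' h : uniq s -> uniq s' -> (forall x, 0 <= h x) ->
  (forall x, x \in s -> x \notin s' -> h x = 0) ->
  \sum_(x <- s) h x <= \sum_(x <- s') h x.
Proof.
move=> us us' h0 hs.
rewrite (@eq_sum_supp s [seq x <- s' | x \in s])// ?filter_uniq//.
- by rewrite big_filter [leLHS]big_mkcond/=; apply: ler_sum => x _; case: ifP.
- by move=> x xs; rewrite mem_filter xs => /hs; exact.
- by move=> x; rewrite mem_filter => /andP[->].
Qed.

Lemma ler_term_sum s h x : (forall y, 0 <= h y) -> x \in s ->
  h x <= \sum_(y <- s) h y.
Proof. by move=> h0 xs; rewrite (big_rem x)//= lerDl; apply: sumr_ge0. Qed.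

End finite_sums.

Section boxes.
Context {R : realType} {d : nat}.
Implicit Types (a b : R) (x y : Zpt d) (f : Zpt d -> R).

Lemma cube_uniq N : uniq (cube d N).
Proof.
rewrite map_inj_uniq ?enum_uniq// => k k' /ffunP kk'.
by apply/ffunP => i; apply/val_inj; have := kk' i; rewrite !ffunE /=; lia.
Qed.

Lemma mem_cube N x : (forall i, (`|x i| <= N)%N) -> x \in cube d N.
Proof.
move=> xN; apply/mapP.
exists [ffun i => inord (absz (x i + N%:Z))]; rewrite ?mem_enum//.
apply/ffunP => i; rewrite !ffunE; move: (x i) (xN i) => z zN.
by rewrite inordK; lia.
Qed.

Lemma inboxP a x : reflect (forall i, `|(x i)%:~R : R| <= a / 2) (inbox a x).
Proof. exact: forallP. Qed.

Lemma inbox_monotone a b x : a <= b -> inbox a x -> inbox b x.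
Proof. by move=> ab /inboxP xa; apply/inboxP => i; have := xa i; lra. Qed.

Lemma inbox_inner_margin a b x y : inbox (b - a) x -> inbox a y -> inbox b y.
Proof.
move=> /inboxP xba /inboxP ya; apply/inboxP => i.
by have := xba i; have := ya i; have := normr_ge0 ((x i)%:~R : R); lra.
Qed.

Lemma inbox0 a : 0 <= a -> inbox a (0 : Zpt d).
Proof. by move=> a0; apply/inboxP => i; rewrite ffunE normr0 divr_ge0. Qed.

Lemma inboxD a b x y : inbox a x -> inbox b y -> inbox (a + b) (x + y).
Proof.
move=> /inboxP xa /inboxP yb; apply/inboxP => i.
rewrite ffunE rmorphD/= mulrDl; apply: le_trans (ler_normD _ _) _.
exact: lerD.
Qed.

Lemma inboxN a x : inbox a (- x) = inbox a x.
Proof. by apply: eq_forallb => i; rewrite ffunE rmorphN normrN. Qed.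

Lemma mem_box a x : (x \in box d a) = inbox a x.
Proof.
rewrite mem_filter andb_idr// => /inboxP xa; apply: mem_cube => i.
have fl0 : 0 <= Num.floor (`|a| / 2) by rewrite floor_ge0 divr_ge0.
rewrite -lez_nat (gez0_abs fl0) abszE floor_ge_int/= intr_norm.
by apply: le_trans (xa i) _; rewrite ler_pM2r ?invr_gt0//; exact: ler_norm.
Qed.

Lemma box_uniq a : uniq (box d a).
Proof. by rewrite filter_uniq// cube_uniq. Qed.

Definition supported_in a f := forall x, ~~ inbox a x -> f x = 0.

Lemma sum_box_shift a b y f : supported_in b f ->
  (forall x, inbox b x -> inbox a (x + y)) ->
  \sum_(x <- box d a) f (x - y) = \sum_(x <- box d b) f x.
Proof.
move=> fb ba; rewrite -(big_map (fun x => x - y) predT f).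
apply: eq_sum_supp; rewrite ?box_uniq ?map_inj_uniq ?box_uniq//.
- exact: addIr.
- by move=> x _; rewrite mem_box; exact: fb.
- move=> x; rewrite mem_box => /ba xa /mapP[].
  by exists (x + y); rewrite ?mem_box ?addrK.
Qed.

Lemma ler_sum_box_shift a y f : (forall x, 0 <= f x) -> supported_in a f ->
  \sum_(x <- box d a) f (x + y) <= \sum_(x <- box d a) f x.
Proof.
move=> f0 fa; rewrite -(big_map (fun x => x + y) predT f).
apply: ler_sum_supp; rewrite ?map_inj_uniq ?box_uniq//; first exact: addIr.
by move=> x _; rewrite mem_box; exact: fa.
Qed.

End boxes.

Section norms.
Context {R : realType} {d : nat}.
Implicit Types (x : Zpt d) (i : 'I_d).

Definition l1norm x : nat := \sum_(i < d) `|x i|%N.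

Lemma sum_unitv i : (\sum_(j < d) (i == j : nat) = 1)%N.
Proof.
rewrite (bigD1 i)//= eqxx big1// => j ji.
by rewrite eq_sym (negbTE ji).
Qed.

Lemma l1norm0 : l1norm 0 = 0%N.
Proof. by rewrite /l1norm big1// => i _; rewrite ffunE. Qed.

Lemma l1normN x : l1norm (- x) = l1norm x.
Proof. by apply: eq_bigr => i _; rewrite ffunE abszN. Qed.

Lemma l1norm_eq0 x : (l1norm x == 0%N) = (x == 0).
Proof.
apply/idP/eqP => [|->]; last by rewrite l1norm0.
rewrite sum_nat_eq0 => /forallP x0; apply/ffunP => i; rewrite ffunE.
by have := x0 i; rewrite absz_eq0 => /eqP.
Qed.

Lemma l1norm_gt0 x : (0 < l1norm x)%N = (x != 0).
Proof. by rewrite lt0n l1norm_eq0. Qed.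

Lemma l1norm_addu x i : (l1norm x <= (l1norm (x + unitv i)%R).+1)%N.
Proof.
rewrite -addn1 -(sum_unitv i) -big_split/=; apply: leq_sum => j _.
by rewrite !ffunE; case: (i == j) => /=; lia.
Qed.

Lemma l1norm_subu x i : (l1norm x <= (l1norm (x - unitv i)%R).+1)%N.
Proof.
rewrite -addn1 -(sum_unitv i) -big_split/=; apply: leq_sum => j _.
by rewrite !ffunE; case: (i == j) => /=; lia.
Qed.

Lemma notin_box_l1norm (a : R) x : ~~ inbox a x -> a / 2 <= (l1norm x)%:R.
Proof.
rewrite negb_forall => /existsP[i]; rewrite -ltNge => /ltW/le_trans; apply.
rewrite -intr_norm -natr_absz ler_nat.
by rewrite /l1norm (bigD1 i)//= leq_addr.
Qed.

Lemma enorm_le_l1norm x : enorm x <= (l1norm x)%:R :> R.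
Proof.
rewrite -(@ler_pXn2r _ 2) ?nnegrE ?sqrtr_ge0// sqr_sqrtr; last first.
  by apply: sumr_ge0 => i _; exact: sqr_ge0.
rewrite /l1norm natr_sum.
pose below_sqr (u w : R) := 0 <= w /\ u <= w ^+ 2.
suff [] : below_sqr (\sum_(i < d) ((x i)%:~R : R) ^+ 2)
                    (\sum_(i < d) `|x i|%N%:R) by [].
apply: (big_ind2 below_sqr) => [|u w u' w' [w0 uw] [w'0 uw']|i _];
  rewrite /below_sqr.
- by rewrite expr0n.
- by split; [exact: addr_ge0 | rewrite sqrrD -mulr_natl; nra].
- by rewrite natr_absz intr_norm real_normK ?num_real.
Qed.

Lemma enorm_unitv_mulrn i n : enorm (unitv i *+ n) = n%:R :> R.
Proof.
rewrite /enorm (bigD1 i)//= big1 => [|j ji]; last first.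
  by rewrite ffunMnE ffunE eq_sym (negbTE ji) mul0rn expr0n.
by rewrite ffunMnE ffunE eqxx addr0 sqrtr_sqr rmorphMn/= ger0_norm// mulrn_wge0.
Qed.

End norms.

Section geometric_sums.
Context {R : realType} {d : nat}.
Implicit Types (a A p : R) (x : Zpt d) (f : Zpt d -> R).

Lemma sum_half_pow N :
  \sum_(j < N.*2.+1) (2^-1 : R) ^+ `|j%:Z - N%:Z|%N = 3 - 2 * 2^-1 ^+ N.
Proof.
elim: N => [|N IH].
  by rewrite big_ord1 !expr0; lra.
rewrite doubleS big_ord_recl big_ord_recr/=.
transitivity (2^-1 ^+ N.+1 + (\sum_(j < N.*2.+1)
    (2^-1 : R) ^+ `|j%:Z - N%:Z|%N + 2^-1 ^+ N.+1)).
  congr (_ + (_ + _)).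
  - by congr (_ ^+ _); lia.
  - by apply: eq_bigr => j _; congr (_ ^+ _); rewrite /bump /=; lia.
  - by congr (_ ^+ _); rewrite /bump /=; lia.
by rewrite IH exprS; lra.
Qed.

Lemma sum_box_half_pow_le a :
  \sum_(x <- box d a) (2^-1 : R) ^+ l1norm x <= 3 ^+ d.
Proof.
set N := `|Num.floor (`|a| / 2)|%N.
apply: (@le_trans _ _ (\sum_(x <- cube d N) (2^-1 : R) ^+ l1norm x)).
  rewrite /box big_filter big_mkcond/=; apply: ler_sum => x _.
  by case: ifP => // _; rewrite exprn_ge0.
rewrite /cube big_map big_enum/=.
under eq_bigr => k _.
  rewrite /l1norm -prodrXr.
  under eq_bigr => i _ do rewrite ffunE.
  over.
rewrite -(@bigA_distr_bigA R 0 1 *%R +%R 'I_d 'I_(N.*2.+1)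
   (fun _ j => (2^-1 : R) ^+ `|j%:Z - N%:Z|%N)).
rewrite -[X in _ ^+ X]card_ord -prodr_const; apply: ler_prod => i _.
have half_pow0 : 0 <= (2^-1 : R) ^+ N by rewrite exprn_ge0.
have half_pow1 : (2^-1 : R) ^+ N <= 1 by rewrite exprn_ile1//; lra.
by rewrite sum_half_pow; apply/andP; split; lra.
Qed.

Lemma sum_box_pow_le a p : 0 <= p <= 2^-1 ->
  \sum_(x <- box d a | x != 0) p ^+ l1norm x <= 2 * 3 ^+ d * p.
Proof.
move=> /andP[p0 p1].
apply: (@le_trans _ _ (\sum_(x <- box d a) 2 * p * 2^-1 ^+ l1norm x)).
  rewrite big_mkcond/=; apply: ler_sum => x _; case: ifPn => [|_]; last first.
    by rewrite !mulr_ge0 ?exprn_ge0.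
  rewrite -l1norm_gt0; case: (l1norm x) => // n _.
  rewrite !exprS.
  have -> : 2 * p * (2^-1 * 2^-1 ^+ n) = p * 2^-1 ^+ n by field.
  by apply: ler_wpM2l => //; apply: lerXn2r; rewrite ?nnegrE.
rewrite -mulr_sumr [leRHS]mulrAC; apply: ler_wpM2l; rewrite ?mulr_ge0//.
exact: sum_box_half_pow_le.
Qed.

Lemma sum_box_geometric_le a A p f : 0 <= A -> 0 <= p <= 2^-1 ->
  (forall x, inbox a x -> x != 0 -> f x <= A * p ^+ l1norm x) ->
  \sum_(x <- box d a | x != 0) f x <= A * (2 * 3 ^+ d * p).
Proof.
move=> A0 p01 fA.
apply: (@le_trans _ _ (A * \sum_(x <- box d a | x != 0) p ^+ l1norm x)).
  rewrite mulr_sumr big_seq_cond [leRHS]big_seq_cond.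
  by apply: ler_sum => x /andP[]; rewrite mem_box; exact: fA.
by apply: ler_wpM2l => //; exact: sum_box_pow_le.
Qed.

End geometric_sums.

Section neighbours.
Context {R : realType} {d : nat}.
Implicit Types (a : R) (x y z : Zpt d) (i : 'I_d) (f g : Zpt d -> R).
Local Notation degree := (2 * d%:R : R).

Definition nbsum f x : R := \sum_(i < d) (f (x + unitv i) + f (x - unitv i)).

Lemma lapE f x : lap f x = nbsum f x - degree * f x.
Proof.
rewrite /lap /nbsum (_ : degree * f x = \sum_(i < d) (f x + f x)); last first.
  by rewrite sumr_const card_ord -[in RHS]mulr_natr; ring.
by rewrite -sumrB; apply: eq_bigr => i _; ring.
Qed.

Lemma nbsum_ge0 f x : (forall y, 0 <= f y) -> 0 <= nbsum f x.
Proof. by move=> f0; apply: sumr_ge0 => i _; rewrite addr_ge0. Qed.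

Lemma ler_nbsum_term f x i : (forall y, 0 <= f y) ->
  f (x + unitv i) <= nbsum f x /\ f (x - unitv i) <= nbsum f x.
Proof.
move=> f0.
have others_ge0 :
    0 <= \sum_(j < d | j != i) (f (x + unitv j) + f (x - unitv j)).
  by apply: sumr_ge0 => j _; rewrite addr_ge0.
rewrite /nbsum (bigD1 i)//=; have := f0 (x + unitv i); have := f0 (x - unitv i).
by split; lra.
Qed.

Lemma ler_nbsum f g x :
  (forall i, f (x + unitv i) <= g (x + unitv i)) ->
  (forall i, f (x - unitv i) <= g (x - unitv i)) -> nbsum f x <= nbsum g x.
Proof. by move=> fp fm; apply: ler_sum => i _; exact: lerD. Qed.

Lemma nbsum_cst (c : R) x : nbsum (fun=> c) x = degree * c.
Proof. by rewrite /nbsum sumr_const card_ord -mulr_natr; ring. Qed.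

Lemma nbsum_shift f x y : nbsum (fun z => f (z - y)) x = nbsum f (x - y).
Proof. by apply: eq_bigr => i _; rewrite !(addrAC x _ (- y)). Qed.

Lemma sqr_nbsum_le f x : nbsum f x ^+ 2 <= degree * nbsum (fun y => f y ^+ 2) x.
Proof.
have := sum_cauchy_schwarz (index_enum 'I_d)
  (fun i => f (x + unitv i) + f (x - unitv i)) (fun=> 1).
under eq_bigr do rewrite mulr1.
under [X in _ <= _ * X]eq_bigr do rewrite expr1n.
rewrite sumr_const card_ord => /le_trans; apply.
rewrite mulrC -mulrA mulrCA ler_wpM2l// /nbsum mulr_sumr.
apply: ler_sum => i _; move: (f _) (f _) => u w.
by have := sqr_ge0 (u - w); rewrite !expr2; lra.
Qed.

Lemma sum_nbsum_le a f : (forall x, 0 <= f x) -> supported_in a f ->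
  \sum_(x <- box d a) nbsum f x <= degree * \sum_(x <- box d a) f x.
Proof.
move=> f0 fa; rewrite -(nbsum_cst _ 0) [leLHS]exchange_big/=.
apply: ler_sum => i _; rewrite big_split/=.
by apply: lerD; exact: ler_sum_box_shift.
Qed.

Lemma sum_sqr_nbsum_le a f : supported_in a f ->
  \sum_(x <- box d a) nbsum f x ^+ 2 <=
  degree ^+ 2 * \sum_(x <- box d a) f x ^+ 2.
Proof.
move=> fa; rewrite expr2 -mulrA.
apply: (@le_trans _ _
    (degree * \sum_(x <- box d a) nbsum (fun y => f y ^+ 2) x)).
  by rewrite mulr_sumr; apply: ler_sum => x _; exact: sqr_nbsum_le.
apply: ler_wpM2l; first by rewrite mulr_ge0.
apply: sum_nbsum_le => x; first exact: sqr_ge0.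
by move=> /fa ->; rewrite expr0n.
Qed.

End neighbours.

Section inner_product.
Context {R : realType} {d : nat}.
Implicit Types (a t : R) (x y : Zpt d) (f g h V : Zpt d -> R).
Local Notation degree := (2 * d%:R : R).

Definition inner a f g : R := \sum_(x <- box d a) f x * g x.

Lemma innerC a f g : inner a f g = inner a g f.
Proof. by apply: eq_bigr => x _; rewrite mulrC. Qed.

Lemma innerBl a t f g h :
  inner a (f \- t \*o g) h = inner a f h - t * inner a g h.
Proof. by rewrite /inner mulr_sumr -sumrB; apply: eq_bigr => x _ /=; ring. Qed.

Lemma innerBr a t f g h :
  inner a h (f \- t \*o g) = inner a h f - t * inner a h g.
Proof. by rewrite innerC innerBl !(innerC _ h). Qed.

Lemma eq_inner a f f' g : (forall x, inbox a x -> f x = f' x) ->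
  inner a f g = inner a f' g.
Proof.
by move=> ff'; apply: eq_big_seq => x; rewrite mem_box => /ff' ->.
Qed.

Lemma innerff a f : inner a f f = \sum_(x <- box d a) f x ^+ 2.
Proof. by []. Qed.

Lemma innerff_ge0 a f : 0 <= inner a f f.
Proof. by apply: sumr_ge0 => x _; exact: sqr_ge0. Qed.

Lemma l2box_sqr a f : l2box a f ^+ 2 = inner a f f.
Proof. by rewrite sqr_sqrtr// innerff_ge0. Qed.

Lemma l2box_ge0 a f : 0 <= l2box a f. Proof. exact: sqrtr_ge0. Qed.

Lemma inner_le_l2box a f g : `|inner a f g| <= l2box a f * l2box a g.
Proof.
rewrite -sqrtrM ?innerff_ge0// -sqrtr_sqr ler_wsqrtr//.
exact: sum_cauchy_schwarz.
Qed.

Lemma sum_mul_shift a y f g : supported_in a f -> supported_in a g ->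
  \sum_(x <- box d a) f x * g (x + y) = \sum_(x <- box d a) f (x - y) * g x.
Proof.
move=> fa ga.
transitivity (\sum_(x <- [seq x + y | x <- box d a]) f (x - y) * g x).
  by rewrite big_map; apply: eq_bigr => x _; rewrite addrK.
apply: eq_sum_supp; rewrite ?map_inj_uniq ?box_uniq//; first exact: addIr.
  by move=> x _; rewrite mem_box => /ga ->; rewrite mulr0.
move=> x _ xy; rewrite fa ?mul0r// -mem_box; apply: contra xy => xy.
by apply/mapP; exists (x - y); rewrite ?subrK.
Qed.

Lemma inner_lapC a f g : supported_in a f -> supported_in a g ->
  inner a f (lap g) = inner a (lap f) g.
Proof.
move=> fa ga; rewrite /inner /lap.
under eq_bigr do rewrite mulr_sumr.
under [RHS]eq_bigr do rewrite mulr_suml.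
rewrite exchange_big [RHS]exchange_big/=; apply: eq_bigr => i _.
have shiftN y : \sum_(x <- box d a) f x * g (x - y) =
    \sum_(x <- box d a) f (x + y) * g x.
  by rewrite sum_mul_shift//; apply: eq_bigr => x _; rewrite opprK.
under eq_bigr do rewrite mulrDr !mulrBr.
under [RHS]eq_bigr do rewrite mulrDl !mulrBl.
by rewrite !big_split/= sum_mul_shift// shiftN addrC.
Qed.

Lemma inner_lap_le0 a f : supported_in a f -> inner a (lap f) f <= 0.
Proof.
move=> fa; have f2a : supported_in a (fun x => f x ^+ 2).
  by move=> x /fa ->; rewrite expr0n.
apply: (@le_trans _ _ (2^-1 * (\sum_(x <- box d a) nbsum (fun y => f y ^+ 2) x -
    degree * \sum_(x <- box d a) f x ^+ 2))); last first.
  by have := sum_nbsum_le (fun x => sqr_ge0 (f x)) f2a; lra.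
rewrite mulr_sumr -sumrB mulr_sumr; apply: ler_sum => x _.
rewrite lapE -(nbsum_cst (f x ^+ 2) x) -(nbsum_cst (f x) x) /nbsum.
rewrite -!sumrB mulr_suml mulr_sumr; apply: ler_sum => i _.
move: (f x) (f (x + _)) (f (x - _)) => u w z.
by have := sqr_ge0 (w - u); have := sqr_ge0 (z - u); rewrite !expr2; lra.
Qed.

Definition schrodinger V f x : R := lap f x + V x * f x.

Lemma schrodingerB V t f g :
  schrodinger V (f \- t \*o g) = schrodinger V f \- t \*o schrodinger V g.
Proof.
apply/funext => x; rewrite /schrodinger /= !lapE/=.
rewrite (_ : nbsum (f \- t \*o g) x = nbsum f x - t * nbsum g x); first ring.
by rewrite /nbsum mulr_sumr -sumrB; apply: eq_bigr => i _ /=; ring.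
Qed.

Lemma inner_schrodingerE a V f g : inner a (schrodinger V f) g =
  inner a (lap f) g + \sum_(x <- box d a) V x * f x * g x.
Proof.
rewrite /inner -big_split; apply: eq_bigr => x _.
by rewrite /schrodinger mulrDl.
Qed.

Lemma inner_schrodingerC a V f g : supported_in a f -> supported_in a g ->
  inner a (schrodinger V f) g = inner a f (schrodinger V g).
Proof.
move=> fa ga; rewrite [RHS]innerC !inner_schrodingerE innerC inner_lapC//.
congr (_ + _).
by apply: eq_bigr => x _; ring.
Qed.

Lemma inner_schrodinger_off_peak a m V f x0 : supported_in a f -> f x0 = 0 ->
  (forall x, inbox a x -> x != x0 -> V x <= m) ->
  inner a (schrodinger V f) f <= m * inner a f f.
Proof.
move=> fa fx0 Vm; rewrite inner_schrodingerE; have := inner_lap_le0 fa.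
suff : \sum_(x <- box d a) V x * f x * f x <= m * inner a f f by lra.
rewrite mulr_sumr !big_seq; apply: ler_sum => x; rewrite mem_box => xa.
have [->|xx0] := eqVneq x x0; first by rewrite fx0 !mulr0.
by rewrite -mulrA; apply: ler_wpM2r; [rewrite -expr2 sqr_ge0 | exact: Vm].
Qed.

End inner_product.

Section ground_state.
Context {R : realType} {d : nat}.
Implicit Types (a lam m : R) (V f g : Zpt d -> R) (x y : Zpt d).
Local Notation degree := (2 * d%:R : R).

Lemma step_toward a x0 y : inbox a x0 -> inbox a y -> y != x0 ->
  exists z i, [/\ inbox a z, (l1norm (z - x0)%R < l1norm (y - x0)%R)%N &
    y = z + unitv i \/ y = z - unitv i].
Proof.
move=> /inboxP x0a /inboxP ya yx0.
have [i yi] : exists i, y i != x0 i.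
  apply/existsP; rewrite -negb_forall; apply: contra yx0 => /forallP yx.
  by apply/eqP/ffunP => i; exact/eqP.
have [s [s1 closer between]] : exists s : int, [/\ s = 1 \/ s = -1,
    (absz (y i - s - x0 i)%R < absz (y i - x0 i)%R)%N &
    `|y i - s| <= Num.max `|x0 i| `|y i|].
  move: (x0 i) (y i) yi => u w uw; have [lt|ge] := ltP u w.
    by exists 1; split; [left | lia | lia].
  by exists (- 1); split; [right | lia | lia].
pose z : Zpt d := [ffun j => y j - s * ((i == j) : nat)%:Z].
have zi : z i = y i - s by rewrite ffunE eqxx mulr1.
have zj j : j != i -> z j = y j.
  by move=> ji; rewrite ffunE eq_sym (negbTE ji) mulr0 subr0.
exists z, i; split.
- apply/inboxP => j; have [->|/zj ->] := eqVneq j i; last exact: ya.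
  rewrite zi -intr_norm; apply: (@le_trans _ _ (Num.max `|x0 i| `|y i|)%:~R).
    by rewrite ler_int.
  by rewrite /Num.max; case: ifP => _; rewrite intr_norm.
- rewrite /l1norm (bigD1 i)//= [ltnRHS](bigD1 i)//= -addSn leq_add//.
    by rewrite !ffunE eqxx mulr1.
  by apply: leq_sum => j ji; rewrite ![(_ - x0)%R _]ffunE zj.
- by case: s1 => s1; [left | right]; apply/ffunP => j; rewrite !ffunE s1; ring.
Qed.

Lemma eigen_nbsum a V lam f x : dirichlet_eigen a V lam f -> inbox a x ->
  nbsum f x = (lam + degree - V x) * f x.
Proof. by move=> [_ _ eq] /eq; rewrite lapE; lra. Qed.

Lemma eigen_gt0 a V lam f x0 : dirichlet_eigen a V lam f ->
  (forall x, 0 <= f x) -> inbox a x0 -> 0 < f x0.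
Proof.
move=> eig f0 x0a; rewrite lt_neqAle f0 andbT; apply/negP => /eqP fx0.
have f_eq0 k x : inbox a x -> (l1norm (x - x0)%R <= k)%N -> f x = 0.
  elim: k x => [|k IH] x xa.
    by rewrite leqn0 l1norm_eq0 subr_eq0 => /eqP ->.
  move=> xk; have [->//|xx0] := eqVneq x x0.
  have [z [i [za zx xz]]] := step_toward x0a xa xx0.
  have nbz : nbsum f z = 0.
    by rewrite (eigen_nbsum eig za) IH ?mulr0// -ltnS (leq_trans zx).
  apply/eqP; rewrite eq_le f0 andbT -nbz.
  by have [le_add le_sub] := ler_nbsum_term z i f0; case: xz => ->.
have [out [x /eqP fx] _] := eig; apply: fx.
by have [xa|/out//] := boolP (inbox a x); exact: f_eq0 (leqnn _).
Qed.

Lemma eigen_ge a V lam f x0 : dirichlet_eigen a V lam f ->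
  (forall x, 0 <= f x) -> inbox a x0 -> V x0 - degree <= lam.
Proof.
move=> eig f0 x0a; have fx0 := eigen_gt0 eig f0 x0a.
by have := nbsum_ge0 x0 f0; rewrite (eigen_nbsum eig x0a) pmulr_lge0//; lra.
Qed.

Lemma eigen_nbsum_ge a V lam f x0 m : dirichlet_eigen a V lam f ->
  (forall x, 0 <= f x) -> inbox a x0 ->
  (forall x, inbox a x -> x != x0 -> m <= V x0 - V x) ->
  forall x, x != x0 -> m * f x <= nbsum f x.
Proof.
move=> eig f0 x0a Vm x xx0; have [xa|xa] := boolP (inbox a x); last first.
  by have [-> //] := eig; rewrite mulr0 nbsum_ge0.
rewrite (eigen_nbsum eig xa) ler_wpM2r//.
by have := eigen_ge eig f0 x0a; have := Vm _ xa xx0; lra.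
Qed.

Lemma ground_state_peak_ge a f x0 m : 0 < m -> degree <= m / 2 ->
  (forall x, 0 <= f x) -> supported_in a f -> inbox a x0 -> inner a f f = 1 ->
  (forall x, x != x0 -> m * f x <= nbsum f x) -> 3 / 4 <= f x0.
Proof.
move=> m0 degree_le f0 fa x0a f1 fm.
have off_peak : m ^+ 2 * (1 - f x0 ^+ 2) <= degree ^+ 2.
  have : \sum_(x <- box d a) nbsum f x ^+ 2 <= degree ^+ 2.
    by have := sum_sqr_nbsum_le fa; rewrite -(innerff a f) f1 mulr1.
  apply: le_trans; rewrite -{1}f1 innerff (bigD1_seq x0)/= ?mem_box ?box_uniq//.
  rewrite addrAC subrr add0r mulr_sumr big_mkcond/=.
  apply: ler_sum => x _; case: ifPn => [xx0|_]; last exact: sqr_ge0.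
  rewrite -exprMn; apply: lerXn2r; last exact: fm.
    by rewrite nnegrE mulr_ge0// ltW.
  by rewrite nnegrE nbsum_ge0.
have degree2 : degree ^+ 2 <= (m / 2) ^+ 2.
  by apply: lerXn2r; rewrite ?nnegrE ?mulr_ge0 ?divr_ge0// ltW.
have m2 : 0 < m ^+ 2 by rewrite exprn_gt0.
have := le_trans off_peak degree2; rewrite expr_div_n ler_pM2l//.
by have := f0 x0; rewrite !expr2; nra.
Qed.

Lemma ground_state_decay a f x0 m : 0 < m -> (forall x, 0 <= f x) ->
  supported_in a f -> inner a f f = 1 ->
  (forall x, x != x0 -> m * f x <= nbsum f x) ->
  forall x, f x <= (degree / m) ^+ l1norm (x - x0).
Proof.
move=> m0 f0 fa f1 fm x.
suff decay k y : (k <= l1norm (y - x0)%R)%N -> f y <= (degree / m) ^+ k.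
  exact: decay.
elim: k y => [|k IH] y ky.
  have [ya|/fa ->//] := boolP (inbox a y).
  rewrite expr0 -(@ler_pXn2r _ 2) ?nnegrE// expr1n -f1 innerff.
  apply: (ler_term_sum (h := fun z => f z ^+ 2)); rewrite ?mem_box// => z.
  exact: sqr_ge0.
have yx0 : y != x0 by rewrite -subr_eq0 -l1norm_gt0 (leq_trans _ ky).
rewrite exprS mulrAC ler_pdivlMr// mulrC (le_trans (fm _ yx0))//.
rewrite -(nbsum_cst ((degree / m) ^+ k) y).
apply: ler_nbsum => i; apply: IH; rewrite -ltnS (leq_trans ky)// addrAC.
  exact: l1norm_addu.
exact: l1norm_subu.
Qed.

End ground_state.

Section spectral_gap.
Context {R : realType} {d : nat}.
Variables (a lam t : R) (V phi : Zpt d -> R).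
Hypothesis phi_eigen : dirichlet_eigen a V lam phi.

Lemma dirichlet_eigen_supported : supported_in a phi.
Proof. by case: phi_eigen. Qed.

Lemma inner_schrodinger_eigen g :
  inner a (schrodinger V phi) g = lam * inner a phi g.
Proof.
have [_ _ eq] := phi_eigen.
rewrite (eq_inner (f' := fun x => lam * phi x)) => [|x xa]; last exact: eq.
by rewrite mulr_sumr; apply: eq_bigr => x _; rewrite mulrA.
Qed.

(* [g] minus the multiple of [phi] agreeing with it at [x0] vanishes at [x0],
   where alone the potential exceeds [t]. *)
Lemma inner_schrodinger_orthogonal g x0 :
  supported_in a g -> inner a g phi = 0 -> phi x0 != 0 ->
  t <= lam -> (forall x, inbox a x -> x != x0 -> V x <= t) ->
  inner a (schrodinger V g) g <= t * inner a g g.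
Proof.
move=> ga gphi phix0 t_lam Vt; have phia := dirichlet_eigen_supported.
pose c := g x0 / phi x0; pose h := g \- c \*o phi.
have ha : supported_in a h.
  by move=> x xa; rewrite /h /= ga// phia// mulr0 subr0.
have hx0 : h x0 = 0 by rewrite /h /c /= divfK// subrr.
have := inner_schrodinger_off_peak ha hx0 Vt.
have Vg_phi : inner a (schrodinger V g) phi = 0.
  rewrite inner_schrodingerC// innerC inner_schrodinger_eigen.
  by rewrite innerC gphi mulr0.
rewrite schrodingerB !innerBl !innerBr !inner_schrodinger_eigen Vg_phi.
rewrite (innerC a phi g) gphi.
have := ler_wpM2r (mulr_ge0 (sqr_ge0 c) (innerff_ge0 a phi)) t_lam.
by rewrite expr2; lra.
Qed.

End spectral_gap.

Section perturbation.
Context {R : realType} {d : nat}.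
Variables (a lam mu t : R) (V phi psi : Zpt d -> R).
Hypothesis phi_eigen : dirichlet_eigen a V lam phi.
Hypothesis phi_unit : inner a phi phi = 1.
Hypotheses (psia : supported_in a psi) (psi_unit : inner a psi psi = 1).
Hypothesis energy_orthogonal : forall g,
  supported_in a g -> inner a g phi = 0 ->
  inner a (schrodinger V g) g <= t * inner a g g.
Hypothesis t_lt_mu : t < mu.

Definition residual x : R := schrodinger V psi x - mu * psi x.

Let phia : supported_in a phi.
Proof. exact: dirichlet_eigen_supported phi_eigen. Qed.

Let p := inner a psi phi.
Let psi_orth := psi \- p \*o phi.
Let psi_ortha : supported_in a psi_orth.
Proof. by move=> x xa; rewrite /psi_orth /= psia// phia// mulr0 subr0. Qed.

Let l2box_phi : l2box a phi = 1.
Proof. by rewrite /l2box -innerff phi_unit sqrtr1. Qed.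

Let psi_orth_phi : inner a psi_orth phi = 0.
Proof. by rewrite innerBl phi_unit mulr1 subrr. Qed.

Let psi_orth_sqr : l2box a psi_orth ^+ 2 = 1 - p ^+ 2.
Proof.
rewrite l2box_sqr innerBl !innerBr psi_unit phi_unit (innerC a phi) -/p.
by ring.
Qed.

Lemma inner_residual_eigen : inner a residual phi = (lam - mu) * p.
Proof.
rewrite (innerBl a mu (schrodinger V psi) psi) -/p.
rewrite inner_schrodingerC// (innerC _ psi).
rewrite (inner_schrodinger_eigen phi_eigen) (innerC a phi) -/p.
by ring.
Qed.

Lemma residual_orthogonal_le : (mu - t) * l2box a psi_orth <= l2box a residual.
Proof.
have [->|orth_neq0] := eqVneq (l2box a psi_orth) 0.
  by rewrite mulr0 l2box_ge0.
have orth_gt0 : 0 < l2box a psi_orth.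
  by rewrite lt_neqAle eq_sym orth_neq0 l2box_ge0.
rewrite -(ler_pM2r orth_gt0) -mulrA -expr2 l2box_sqr.
have residual_orth : inner a residual psi_orth =
    inner a (schrodinger V psi_orth) psi_orth - mu * inner a psi_orth psi_orth.
  rewrite (innerBl a mu (schrodinger V psi) psi) schrodingerB innerBl.
  rewrite (innerBl _ _ psi) (inner_schrodinger_eigen phi_eigen).
  by rewrite (innerC a phi) psi_orth_phi; ring.
have := energy_orthogonal psi_ortha psi_orth_phi.
have := inner_le_l2box a residual psi_orth.
by rewrite residual_orth ler_norml => /andP[+ _]; lra.
Qed.

Lemma eigenvector_perturbation : 0 <= p ->
  (mu - t) * l2box a (phi \- psi) <= 2 * l2box a residual.
Proof.
move=> p0; have p1 : p <= 1.
  have := inner_le_l2box a psi phi; rewrite l2box_phi /l2box -innerff.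
  by rewrite psi_unit sqrtr1 mulr1 ler_norml => /andP[].
have diff_sqr : l2box a (phi \- psi) ^+ 2 = 2 - 2 * p.
  have -> : phi \- psi = phi \- 1 \*o psi.
    by apply/funext => x; rewrite /= mul1r.
  rewrite l2box_sqr innerBl !innerBr psi_unit phi_unit (innerC a phi) -/p.
  by ring.
have diff_le : l2box a (phi \- psi) <= 2 * l2box a psi_orth.
  rewrite -(@ler_pXn2r _ 2) ?nnegrE ?mulr_ge0 ?l2box_ge0//.
  by rewrite exprMn psi_orth_sqr diff_sqr; nra.
apply: (@le_trans _ _ ((mu - t) * (2 * l2box a psi_orth))).
  by apply: ler_wpM2l => //; rewrite subr_ge0 ltW.
by rewrite mulrCA ler_pM2l// residual_orthogonal_le.
Qed.

Lemma eigenvalue_perturbation : 2^-1 <= p ->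
  (mu - t) * `|lam - mu - inner a residual psi| <= 3 * l2box a residual ^+ 2.
Proof.
move=> p_ge; have rho0 := l2box_ge0 a residual.
have orth0 := l2box_ge0 a psi_orth.
have gap0 : 0 < mu - t by rewrite subr_gt0.
have shift_le : `|lam - mu| <= 2 * l2box a residual.
  have := inner_le_l2box a residual phi.
  rewrite inner_residual_eigen l2box_phi normrM [`|p|]ger0_norm; last lra.
  by have := normr_ge0 (lam - mu); nra.
have expansion : lam - mu - inner a residual psi =
    l2box a psi_orth ^+ 2 * (lam - mu) - inner a residual psi_orth.
  by rewrite psi_orth_sqr (innerBr a p psi phi) inner_residual_eigen; ring.
have orth_le1 : l2box a psi_orth <= 1.
  by rewrite -(@ler_pXn2r _ 2) ?nnegrE// psi_orth_sqr expr1n gerBl sqr_ge0.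
have orth_le := residual_orthogonal_le.
rewrite expansion; apply: (@le_trans _ _ ((mu - t) *
    (l2box a psi_orth * (2 * l2box a residual) +
     l2box a residual * l2box a psi_orth))).
  apply: ler_wpM2l; first exact: ltW.
  apply: le_trans (ler_normB _ _) (lerD _ (inner_le_l2box _ _ _)).
  rewrite normrM normrX (ger0_norm orth0).
  apply: ler_pM => //; first by rewrite exprn_ge0.
  by rewrite expr2 ler_piMl.
by have := ler_wpM2r rho0 orth_le; rewrite expr2; lra.
Qed.

End perturbation.

Section profile.
Context {R : realType} {d : nat}.
Variables (r lbar m : R) (U phibar : Zpt d -> R).
Local Notation degree := (2 * d%:R : R).
Hypotheses (m_gt0 : 0 < m) (degree_le : degree <= m / 2) (r_ge0 : 0 <= r).
Hypothesis phibar_ground : principal_eigenpair r U lbar phibar.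
Hypothesis U0 : U 0 = 0.
Hypothesis U_peak : forall y, inbox r y -> y != 0 -> m <= - U y.

Let phibar_eigen : dirichlet_eigen r U lbar phibar.
Proof. by case: phibar_ground. Qed.
Let phibar_ge0 y : 0 <= phibar y. Proof. by case: phibar_ground. Qed.
Let phibar_supported : supported_in r phibar.
Proof. exact: dirichlet_eigen_supported phibar_eigen. Qed.
Let phibar_unit : inner r phibar phibar = 1. Proof. by case: phibar_ground. Qed.

Lemma profile_eigenvalue_ge : - degree <= lbar.
Proof.
by have := eigen_ge phibar_eigen phibar_ge0 (inbox0 r_ge0); rewrite U0 sub0r.
Qed.

Let profile_nbsum_ge y : y != 0 -> m * phibar y <= nbsum phibar y.
Proof.
apply: (eigen_nbsum_ge phibar_eigen phibar_ge0 (inbox0 r_ge0)) => z.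
by rewrite U0 sub0r; exact: U_peak.
Qed.

Lemma profile_peak_ge : 3 / 4 <= phibar 0.
Proof.
exact: (ground_state_peak_ge m_gt0 degree_le phibar_ge0 phibar_supported
  (inbox0 r_ge0) phibar_unit profile_nbsum_ge).
Qed.

Lemma profile_decay y : phibar y <= (degree / m) ^+ l1norm y.
Proof.
rewrite -[y in l1norm y]subr0.
exact: (ground_state_decay m_gt0 phibar_ge0 phibar_supported phibar_unit
  profile_nbsum_ge).
Qed.

Lemma sum_profile_le A B (w : Zpt d -> R) : 0 <= A -> 0 <= B ->
  B * (degree / m) ^+ 2 <= 2^-1 ->
  (forall y, inbox r y -> y != 0 -> w y <= A * B ^+ l1norm y) ->
  \sum_(y <- box d r | y != 0) w y * phibar y ^+ 2 <=
    A * (2 * 3 ^+ d * (B * (degree / m) ^+ 2)).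
Proof.
move=> A0 B0 Bq wAB; apply: sum_box_geometric_le => //.
  by rewrite Bq mulr_ge0// sqr_ge0.
move=> y yr y0; rewrite exprMn (exprAC _ 2) [leRHS]mulrA.
apply: (@le_trans _ _ (A * B ^+ l1norm y * phibar y ^+ 2)).
  by apply: ler_wpM2r; [exact: sqr_ge0 | exact: wAB].
apply: ler_wpM2l; first by rewrite mulr_ge0// exprn_ge0.
apply: lerXn2r; rewrite ?nnegrE ?profile_decay//.
by rewrite exprn_ge0// divr_ge0 ?mulr_ge0// ltW.
Qed.

Lemma profile_first_moment_le :
  \sum_(y <- box d r) (l1norm y).+1%:R * phibar y ^+ 2 <= 1 + 3 ^+ d.
Proof.
have q_le : degree / m <= 2^-1 by rewrite ler_pdivrMr// [leRHS]mulrC.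
have q_ge0 : 0 <= degree / m by rewrite divr_ge0 ?mulr_ge0// ltW.
have q2_le : 2 * (degree / m) ^+ 2 <= 2^-1 by rewrite expr2; nra.
rewrite (bigD1_seq 0)/= ?mem_box ?inbox0 ?box_uniq//; apply: lerD.
  rewrite l1norm0 mul1r -phibar_unit innerff.
  by apply: (ler_term_sum (h := fun y => phibar y ^+ 2));
    rewrite ?mem_box ?inbox0// => y; exact: sqr_ge0.
apply: (@le_trans _ _ (1 * (2 * 3 ^+ d * (2 * (degree / m) ^+ 2)))).
  apply: sum_profile_le => // y _ _.
  by rewrite mul1r -natrX ler_nat; exact: ltn_expl.
have pow3 : 0 <= 3 ^+ d :> R by rewrite exprn_ge0.
by rewrite mul1r; nra.
Qed.

End profile.

Section translated_profile.
Context {R : realType} {d : nat}.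
Variables (a r lam lbar m : R) (V U phi phibar : Zpt d -> R) (x0 : Zpt d).
Local Notation degree := (2 * d%:R : R).
Hypotheses (m_gt0 : 0 < m) (degree_le : degree <= m / 2) (r_gt0 : 0 < r).
Hypothesis x0_inner : inbox (a - r) x0.
Hypothesis phi_ground : principal_eigenpair a V lam phi.
Hypothesis phibar_ground : principal_eigenpair r U lbar phibar.
Hypothesis V_peak : forall x, inbox a x -> x != x0 -> m <= V x0 - V x.
Hypothesis U0 : U 0 = 0.
Hypothesis U_peak : forall y, inbox r y -> y != 0 -> m <= - U y.

Definition translate y : R := phibar (y - x0).
Definition mismatch y : R := V (y + x0) - V x0 - U y.

Local Notation mu := (lbar + V x0).

Let phi_eigen : dirichlet_eigen a V lam phi. Proof. by case: phi_ground. Qed.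
Let phi_ge0 x : 0 <= phi x. Proof. by case: phi_ground. Qed.
Let phi_unit : inner a phi phi = 1. Proof. by case: phi_ground. Qed.
Let phibar_eigen : dirichlet_eigen r U lbar phibar.
Proof. by case: phibar_ground. Qed.
Let phibar_ge0 x : 0 <= phibar x. Proof. by case: phibar_ground. Qed.
Let phibar_supported : supported_in r phibar.
Proof. exact: dirichlet_eigen_supported phibar_eigen. Qed.
Let phibar_unit : inner r phibar phibar = 1. Proof. by case: phibar_ground. Qed.

Let r0 : inbox r (0 : Zpt d). Proof. exact/inbox0/ltW. Qed.

Let shift_inbox y : inbox r y -> inbox a (y + x0).
Proof. by move=> yr; have := inboxD yr x0_inner; rewrite subrKC. Qed.

Let x0_inbox : inbox a x0. Proof. by rewrite -[x0]add0r shift_inbox. Qed.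

Let shift_supported (f : Zpt d -> R) : supported_in r f ->
  supported_in a (fun x => f (x - x0)).
Proof.
by move=> fr x xa; apply: fr; apply: contra xa => /shift_inbox; rewrite subrK.
Qed.

Let translate_supported : supported_in a translate.
Proof. exact: shift_supported. Qed.

Lemma inner_translate : inner a translate translate = 1.
Proof.
rewrite innerff (sum_box_shift (b := r) (f := fun y => phibar y ^+ 2))//.
by move=> y /phibar_supported ->; rewrite expr0n.
Qed.

Lemma residual_translate_in x : inbox r (x - x0) ->
  residual mu V translate x = mismatch (x - x0) * translate x.
Proof.
move=> xr; have [_ _ /(_ _ xr)] := phibar_eigen.
rewrite /residual /schrodinger /mismatch /translate !lapE nbsum_shift subrK.
by lra.
Qed.

Lemma residual_translate_out x : ~~ inbox r (x - x0) ->
  residual mu V translate x = nbsum phibar (x - x0).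
Proof.
move=> xr; rewrite /residual /schrodinger /translate lapE nbsum_shift.
by rewrite (phibar_supported xr); ring.
Qed.

Lemma inner_residual_translate :
  inner a (residual mu V translate) translate =
  \sum_(y <- box d r) mismatch y * phibar y ^+ 2.
Proof.
pose first_order y := mismatch y * phibar y ^+ 2.
have first_order_supported : supported_in r first_order.
  move=> y /phibar_supported; rewrite /first_order => ->.
  by rewrite expr0n mulr0.
rewrite -[RHS](sum_box_shift (a := a) (y := x0) first_order_supported)//.
apply: eq_bigr => x _; have [xr|xr] := boolP (inbox r (x - x0)).
  by rewrite residual_translate_in// /first_order expr2 mulrA.
by rewrite first_order_supported// /translate phibar_supported// mulr0.
Qed.

(* A neighbour [z] of a site outside the box of side [r] satisfies
   [r / 2 <= l1norm z + 1]. *)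
Lemma sqr_nbsum_out_le (f : Zpt d -> R) y : ~~ inbox r y ->
  nbsum f y ^+ 2 <=
  degree * nbsum (fun z => 2 / r * ((l1norm z).+1%:R * f z ^+ 2)) y.
Proof.
move=> yr; apply: le_trans (sqr_nbsum_le _ _) _; apply: ler_wpM2l => //.
have weight_ge1 z : (l1norm y <= (l1norm z).+1)%N ->
    f z ^+ 2 <= 2 / r * ((l1norm z).+1%:R * f z ^+ 2).
  move=> yz; rewrite mulrA ler_peMl ?sqr_ge0// mulrAC ler_pdivlMr// mul1r.
  have : (l1norm y)%:R <= (l1norm z).+1%:R :> R by rewrite ler_nat.
  by have := notin_box_l1norm yr; lra.
apply: ler_nbsum => i; apply: weight_ge1; first exact: l1norm_addu.
exact: l1norm_subu.
Qed.

Definition residual_bound : R :=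
  \sum_(y <- box d r) mismatch y ^+ 2 * phibar y ^+ 2 +
  2 * degree ^+ 2 / r * \sum_(y <- box d r) (l1norm y).+1%:R * phibar y ^+ 2.

Lemma l2box_residual_translate_le :
  l2box a (residual mu V translate) ^+ 2 <= residual_bound.
Proof.
pose inside y := mismatch y ^+ 2 * phibar y ^+ 2.
pose outside y := 2 / r * ((l1norm y).+1%:R * phibar y ^+ 2).
have inside_ge0 y : 0 <= inside y by rewrite mulr_ge0 ?sqr_ge0.
have outside_ge0 y : 0 <= outside y.
  by rewrite !mulr_ge0 ?sqr_ge0// invr_ge0 ltW.
have inside_supported : supported_in r inside.
  by move=> y /phibar_supported; rewrite /inside => ->; rewrite expr0n mulr0.
have outside_supported : supported_in r outside.
  by move=> y /phibar_supported; rewrite /outside => ->; rewrite expr0n !mulr0.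
rewrite l2box_sqr innerff; apply: (@le_trans _ _ (\sum_(x <- box d a)
    (inside (x - x0) + degree * nbsum (fun y => outside (y - x0)) x))).
  apply: ler_sum => x _; have [xr|xr] := boolP (inbox r (x - x0)).
    by rewrite residual_translate_in// exprMn ler_wpDr// mulr_ge0// nbsum_ge0.
  by rewrite residual_translate_out// nbsum_shift ler_wpDl// sqr_nbsum_out_le.
rewrite big_split/= -mulr_sumr; apply: lerD.
  by rewrite (sum_box_shift (b := r)).
have -> : 2 * degree ^+ 2 / r * (\sum_(y <- box d r)
    (l1norm y).+1%:R * phibar y ^+ 2) =
    degree * (degree * \sum_(x <- box d a) outside (x - x0)).
  by rewrite (sum_box_shift (b := r))// -mulr_sumr; ring.
apply: ler_wpM2l => //; apply: sum_nbsum_le => //.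
exact: shift_supported.
Qed.

Let phi_nbsum x : x != x0 -> m * phi x <= nbsum phi x.
Proof. exact: (eigen_nbsum_ge phi_eigen phi_ge0 x0_inbox V_peak). Qed.

Let overlap_ge : 2^-1 <= inner a translate phi.
Proof.
have phi_peak := ground_state_peak_ge m_gt0 degree_le phi_ge0
  (dirichlet_eigen_supported phi_eigen) x0_inbox phi_unit phi_nbsum.
have phibar_peak :=
  profile_peak_ge m_gt0 degree_le (ltW r_gt0) phibar_ground U0 U_peak.
have : translate x0 * phi x0 <= inner a translate phi.
  apply: (ler_term_sum (h := fun x => translate x * phi x)); rewrite ?mem_box//.
  by move=> x; rewrite mulr_ge0// phibar_ge0.
apply: le_trans; rewrite /translate subrr.
by have := phi_ge0 x0; have := phibar_ge0 0; nra.
Qed.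

Let gap : m / 2 <= mu - (V x0 - m).
Proof.
have := profile_eigenvalue_ge (ltW r_gt0) phibar_ground U0.
by have := degree_le; lra.
Qed.

Let energy_orthogonal g : supported_in a g -> inner a g phi = 0 ->
  inner a (schrodinger V g) g <= (V x0 - m) * inner a g g.
Proof.
move=> ga gphi.
apply: (inner_schrodinger_orthogonal phi_eigen (x0 := x0)) => //.
- by rewrite gt_eqF// (eigen_gt0 phi_eigen).
- have := eigen_ge phi_eigen phi_ge0 x0_inbox.
  by have := degree_le; have := m_gt0; lra.
- by move=> x xa xx0; have := V_peak xa xx0; lra.
Qed.

Let gap_gt0 : V x0 - m < mu. Proof. by have := gap; have := m_gt0; lra. Qed.

Lemma translate_eigenvector_le :
  m * l2box a (phi \- translate) <= 4 * Num.sqrt residual_bound.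
Proof.
have overlap_ge0 : 0 <= inner a translate phi by apply: le_trans overlap_ge.
have := eigenvector_perturbation phi_eigen phi_unit translate_supported
  inner_translate energy_orthogonal gap_gt0 overlap_ge0.
have := ler_wsqrtr l2box_residual_translate_le.
rewrite sqrtr_sqr ger0_norm ?l2box_ge0//.
have := ler_wpM2r (l2box_ge0 a (phi \- translate)) gap.
by lra.
Qed.

Lemma translate_eigenvalue_le :
  m * `|lam - lbar - V x0 - \sum_(y <- box d r) mismatch y * phibar y ^+ 2|
    <= 6 * residual_bound.
Proof.
rewrite -inner_residual_translate.
have -> : lam - lbar - V x0 = lam - mu by ring.
have := eigenvalue_perturbation phi_eigen phi_unit translate_supported
  inner_translate energy_orthogonal gap_gt0 overlap_ge.
set remainder := lam - mu - _ => remainder_le.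
have := ler_wpM2r (normr_ge0 remainder) gap.
have := l2box_residual_translate_le.
by lra.
Qed.

End translated_profile.

Section fixed_scale.
Context {R : realType} {d : nat}.
(* [b] stands for [expR c'], where [c'] is the constant of assumption (II). *)
Variables (a D r RR kappa c b lbar lam : R).
Variables (v xi phibar phi : Zpt d -> R) (x0 : Zpt d).
Local Notation degree := (2 * d%:R : R).
Local Notation theta := ((2 * d + 1)%:R : R).

Definition decay_const : R := 2 * degree / c.

Definition ratio_threshold : R :=
  5 * theta / 2 + 2 * decay_const + 2 * (b ^+ 2 * decay_const ^+ 2).

Definition residual_const : R :=
  2 * 3 ^+ d * (4 * b + 2 * theta ^+ 2 * b ^+ 2) * decay_const ^+ 2 +
  2 * degree ^+ 2 * (1 + 3 ^+ d).

Definition eigenvalue_const : R :=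
  12 / c * residual_const + theta * (2 * 3 ^+ d * b * decay_const ^+ 2).

Definition eigenvector_const : R := 8 / c * Num.sqrt residual_const.

Definition noise y : R := xi (y + x0) - xi x0 * v y.

Local Notation eps := (D / a).
Local Notation K := decay_const.
Local Notation well := (fun y => - (a * (1 - v y))).
Local Notation deviation := (xi x0 - a).
Local Notation error := (eps `^ (1 - 2 * kappa) * `|deviation| + a^-1).

Hypotheses (D_ge1 : 1 <= D) (a_gt0 : 0 < a) (a_le_r : a <= r).
Hypotheses (c_gt0 : 0 < c) (b_ge1 : 1 <= b) (kappa_le : kappa <= 2^-1).
Hypothesis ratio_small : ratio_threshold * eps <= 1.
Hypothesis v0 : v 0 = 1.
Hypothesis v_lower : forall y, y != 0 -> 1 - v y <= b ^+ l1norm y / D.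
Hypothesis v_upper : forall y, y != 0 -> c / D <= 1 - v y.
Hypothesis x0_inner : inbox (RR - r) x0.
Hypothesis phibar_ground : principal_eigenpair r well lbar phibar.
Hypothesis phi_ground : principal_eigenpair RR xi lam phi.
Hypothesis deviation_le : `|deviation| <= theta.
Hypothesis noise_le : forall y, inbox (2 * RR) y ->
  `|noise y| <= 10^-1 * (a * (1 - v y)).
Hypothesis sqr_noise_le : forall y, inbox r y -> y != 0 ->
  noise y ^+ 2 <= 2 / D * (1 + `|deviation| * a) *
                  (b * (a / D) `^ (2 * kappa)) ^+ l1norm y.

(* Half of the lower bound [a * c / D] for [a * (1 - v y)] off the origin. *)
Let m := c / (2 * eps).

Let D_gt0 : 0 < D. Proof. exact: lt_le_trans D_ge1. Qed.
Let eps_gt0 : 0 < eps. Proof. exact: divr_gt0. Qed.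
Let r_gt0 : 0 < r. Proof. exact: lt_le_trans a_le_r. Qed.
Let b_ge0 : 0 <= b. Proof. exact: le_trans b_ge1. Qed.
Let m_gt0 : 0 < m. Proof. by rewrite divr_gt0// mulr_gt0. Qed.
Let cinv_ge0 : 0 <= c^-1. Proof. by rewrite invr_ge0 ltW. Qed.
Let ainv_gt0 : 0 < a^-1. Proof. by rewrite invr_gt0. Qed.
Let K_ge0 : 0 <= K. Proof. by rewrite divr_ge0 ?mulr_ge0// ltW. Qed.

Lemma ratio_threshold_gt0 : 0 < ratio_threshold.
Proof.
rewrite /ratio_threshold -exprMn ltr_wpDr ?(mulr_ge0 _ (sqr_ge0 _))//.
by rewrite ltr_wpDr ?mulr_ge0.
Qed.

Lemma residual_const_ge0 : 0 <= residual_const.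
Proof. by rewrite addr_ge0// !mulr_ge0 ?sqr_ge0 ?addr_ge0// !mulr_ge0. Qed.

Lemma eigenvalue_const_ge0 : 0 <= eigenvalue_const.
Proof. by rewrite addr_ge0// !mulr_ge0 ?residual_const_ge0. Qed.

Lemma eigenvector_const_ge0 : 0 <= eigenvector_const.
Proof. by rewrite !mulr_ge0 ?sqrtr_ge0. Qed.

Let ratio_bounds : [/\ 5 * theta * eps <= 2, K * eps <= 2^-1 &
  b ^+ 2 * K ^+ 2 * eps <= 2^-1].
Proof.
have theta_eps0 : 0 <= theta * eps by rewrite mulr_ge0// ltW.
have K_eps0 : 0 <= K * eps by rewrite mulr_ge0// ltW.
have bK_eps0 : 0 <= b ^+ 2 * K ^+ 2 * eps.
  by rewrite mulr_ge0 ?(ltW eps_gt0)// mulr_ge0 ?sqr_ge0.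
by move: ratio_small; rewrite /ratio_threshold !mulrDl => le1; split; lra.
Qed.

Lemma ratio_le1 : eps <= 1.
Proof.
have [theta_eps _ _] := ratio_bounds; have : 1 <= theta by rewrite ler1n addn1.
by have := eps_gt0; nra.
Qed.

Let a_ge1 : 1 <= a.
Proof.
by have := ratio_le1; rewrite ler_pdivrMr// mul1r; exact: le_trans.
Qed.

Let theta_le : 5 * theta <= 2 * a.
Proof.
have [+ _ _] := ratio_bounds; rewrite mulrA ler_pdivrMr//; apply: le_trans.
by rewrite ler_peMr// mulr_ge0.
Qed.

Let degree_div_m : degree / m = K * eps.
Proof. by rewrite /m /decay_const; field; rewrite !gt_eqF. Qed.

Let degree_le : degree <= m / 2.
Proof.
by have [_ + _] := ratio_bounds; rewrite -degree_div_m ler_pdivrMr//; lra.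
Qed.

Let well_depth_ge y : y != 0 -> 2 * m <= a * (1 - v y).
Proof.
move=> y0; have -> : 2 * m = a * (c / D) by rewrite /m; field; rewrite !gt_eqF.
by rewrite ler_pM2l// v_upper.
Qed.

Let one_sub_v_ge0 y : 0 <= 1 - v y.
Proof.
have [->|y0] := eqVneq y 0; first by rewrite v0 subrr.
by apply: le_trans (v_upper y0); rewrite divr_ge0// ltW.
Qed.

Let well0 : well 0 = 0. Proof. by rewrite /= v0 subrr mulr0 oppr0. Qed.

Let well_peak y : inbox r y -> y != 0 -> m <= - well y.
Proof. by move=> _ /well_depth_ge; rewrite opprK; have := m_gt0; lra. Qed.

Let xi_peak x : inbox RR x -> x != x0 -> m <= xi x0 - xi x.
Proof.
move=> xR xx0; have y0 : x - x0 != 0 by rewrite subr_eq0.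
have y2R : inbox (2 * RR) (x - x0).
  rewrite mulr_natl mulr2n inboxD// inboxN; apply: inbox_monotone x0_inner.
  by rewrite gerBl ltW.
have := noise_le y2R; rewrite ler_norml /noise subrK => /andP[_].
have := well_depth_ge y0.
have : 2 / 5 * a * (1 - v (x - x0)) >= (a - xi x0) * (1 - v (x - x0)).
  apply: ler_wpM2r => //; move: deviation_le; rewrite ler_norml => /andP[+ _].
  by have := theta_le; lra.
by move: (v (x - x0)) => u; lra.
Qed.

Let mismatchE y : mismatch xi well x0 y = noise y - deviation * (1 - v y).
Proof. by rewrite /mismatch /noise; ring. Qed.

Let mismatch0 : mismatch xi well x0 0 = 0.
Proof. by rewrite mismatchE /noise add0r v0; ring. Qed.

Let growth_eps : (a / D) `^ (2 * kappa) * eps = eps `^ (1 - 2 * kappa).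
Proof.
have eps_ge0 := ltW eps_gt0.
rewrite -[a / D]invf_div -[(D / a)^-1]powR_inv1// -powRrM.
rewrite -[X in _ * X = _]powRr1// -powRD ?(gt_eqF eps_gt0) ?implybT//.
by congr powR; ring.
Qed.

Let eps_powR_le1 : eps `^ (1 - 2 * kappa) <= 1.
Proof.
have := @ge0_ler_powR R (1 - 2 * kappa) _ eps 1.
rewrite powR1; apply; rewrite ?nnegrE ?(ltW eps_gt0) ?ratio_le1//.
by have := kappa_le; lra.
Qed.

Let weighted_sum_le A B (w : Zpt d -> R) :
  0 <= A -> 0 <= B -> B * eps <= b ^+ 2 ->
  (forall y, inbox r y -> y != 0 -> w y <= A * B ^+ l1norm y) ->
  \sum_(y <- box d r | y != 0) w y * phibar y ^+ 2 <=
  A * (2 * 3 ^+ d * (B * (K * eps) ^+ 2)).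
Proof.
move=> A0 B0 B_le wAB; rewrite -degree_div_m.
apply: (sum_profile_le m_gt0 (ltW r_gt0) phibar_ground well0 well_peak) => //.
have [_ _ bK] := ratio_bounds; apply: le_trans bK; rewrite degree_div_m.
have -> : B * (K * eps) ^+ 2 = B * eps * (K ^+ 2 * eps) by ring.
by rewrite -[leRHS]mulrA ler_wpM2r// mulr_ge0 ?sqr_ge0// ltW.
Qed.

Let b_le_sqr : b <= b ^+ 2. Proof. by rewrite expr2 ler_peMl. Qed.

Lemma sum_one_sub_v_le :
  \sum_(y <- box d r | y != 0) (1 - v y) * phibar y ^+ 2 <=
  2 * 3 ^+ d * b * K ^+ 2 * (eps * a^-1).
Proof.
have -> : 2 * 3 ^+ d * b * K ^+ 2 * (eps * a^-1) =
    D^-1 * (2 * 3 ^+ d * (b * (K * eps) ^+ 2)).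
  by move: (3 ^+ d) K => pow3 k; field; rewrite !gt_eqF.
apply: weighted_sum_le => //.
- by rewrite invr_ge0 ltW.
- by apply: le_trans b_le_sqr; rewrite ler_piMr ?ratio_le1.
- by move=> y _ y0; rewrite mulrC v_lower.
Qed.

Lemma sum_sqr_one_sub_v_le :
  \sum_(y <- box d r | y != 0) (1 - v y) ^+ 2 * phibar y ^+ 2 <=
  2 * 3 ^+ d * b ^+ 2 * K ^+ 2 * a^-1.
Proof.
have inv_a_le : 2 * 3 ^+ d * b ^+ 2 * K ^+ 2 * (a^-1 * a^-1) <=
    2 * 3 ^+ d * b ^+ 2 * K ^+ 2 * a^-1.
  apply: ler_wpM2l; first by rewrite !mulr_ge0.
  by rewrite ler_piMr ?(ltW ainv_gt0)// invf_le1.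
apply: le_trans inv_a_le.
have -> : 2 * 3 ^+ d * b ^+ 2 * K ^+ 2 * (a^-1 * a^-1) =
    D^-1 ^+ 2 * (2 * 3 ^+ d * (b ^+ 2 * (K * eps) ^+ 2)).
  by move: (3 ^+ d) K => pow3 k; field; rewrite !gt_eqF.
apply: weighted_sum_le; rewrite ?sqr_ge0//.
  by rewrite ler_piMr ?sqr_ge0 ?ratio_le1.
move=> y _ y0; rewrite (exprAC _ 2) -exprMn.
apply: lerXn2r; rewrite ?nnegrE//.
  by rewrite mulr_ge0 ?invr_ge0 ?exprn_ge0// ltW.
by rewrite mulrC v_lower.
Qed.

Let inv_a_le_error : a^-1 <= error.
Proof. by rewrite lerDr mulr_ge0// powR_ge0. Qed.

Let error_ge0 : 0 <= error.
Proof. by apply: le_trans inv_a_le_error; exact: ltW. Qed.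

Lemma sum_sqr_noise_le :
  \sum_(y <- box d r | y != 0) noise y ^+ 2 * phibar y ^+ 2 <=
  2 * 3 ^+ d * (2 * b) * K ^+ 2 * error.
Proof.
set g := (a / D) `^ (2 * kappa); set A := 2 / D * (1 + `|deviation| * a).
apply: (@le_trans _ _ (A * (2 * 3 ^+ d * (b * g * (K * eps) ^+ 2)))).
  apply: weighted_sum_le => //.
  - by rewrite mulr_ge0 ?divr_ge0 ?addr_ge0 ?mulr_ge0// ltW.
  - by rewrite mulr_ge0 ?powR_ge0.
  - by rewrite -mulrA growth_eps; apply: le_trans b_le_sqr; rewrite ler_piMr.
have -> : A * (2 * 3 ^+ d * (b * g * (K * eps) ^+ 2)) =
    2 * 3 ^+ d * (2 * b) * K ^+ 2 * (g * eps * `|deviation| + g * eps * a^-1).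
  rewrite /A; move: (3 ^+ d) K g `|deviation| => pow3 k h u.
  by field; rewrite !gt_eqF.
rewrite growth_eps; apply: ler_wpM2l; first by rewrite !mulr_ge0.
by rewrite lerD2l ler_piMl// ltW.
Qed.

Lemma sum_sqr_mismatch_le :
  \sum_(y <- box d r) mismatch xi well x0 y ^+ 2 * phibar y ^+ 2 <=
  2 * 3 ^+ d * (4 * b + 2 * theta ^+ 2 * b ^+ 2) * K ^+ 2 * error.
Proof.
rewrite (bigD1_seq 0)/= ?mem_box ?inbox0 ?box_uniq ?(ltW r_gt0)//.
rewrite mismatch0 expr0n mul0r add0r; apply: (@le_trans _ _
    (2 * (\sum_(y <- box d r | y != 0) noise y ^+ 2 * phibar y ^+ 2) +
     2 * theta ^+ 2 *
       \sum_(y <- box d r | y != 0) (1 - v y) ^+ 2 * phibar y ^+ 2)).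
  rewrite !mulr_sumr -big_split/=; apply: ler_sum => y _.
  rewrite mismatchE [2 * _]mulrA [2 * theta ^+ 2 * _]mulrA -mulrDl.
  apply: ler_wpM2r; first exact: sqr_ge0.
  have : deviation ^+ 2 * (1 - v y) ^+ 2 <= theta ^+ 2 * (1 - v y) ^+ 2.
    apply: ler_wpM2r; first exact: sqr_ge0.
    rewrite -(real_normK (num_real deviation)).
    by apply: lerXn2r; rewrite ?nnegrE.
  rewrite -!exprMn; have := sqr_ge0 (noise y + deviation * (1 - v y)).
  by rewrite sqrrB sqrrD; lra.
have := sum_sqr_noise_le.
have := ler_wpM2l (mulr_ge0 (ler0n R 2) (sqr_ge0 theta)) sum_sqr_one_sub_v_le.
have : 2 * 3 ^+ d * (2 * theta ^+ 2 * b ^+ 2) * K ^+ 2 * a^-1 <=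
    2 * 3 ^+ d * (2 * theta ^+ 2 * b ^+ 2) * K ^+ 2 * error.
  by apply: ler_wpM2l => //; rewrite !mulr_ge0.
by move: (theta ^+ 2) (K ^+ 2) error => th k e; lra.
Qed.

Lemma residual_bound_le :
  residual_bound r xi well phibar x0 <= residual_const * error.
Proof.
rewrite [leRHS]mulrDl; apply: lerD; first exact: sum_sqr_mismatch_le.
apply: (@le_trans _ _ (2 * degree ^+ 2 * a^-1 * (1 + 3 ^+ d))).
  apply: ler_pM.
  - by rewrite mulr_ge0// invr_ge0 ltW.
  - by apply: sumr_ge0 => y _; rewrite mulr_ge0 ?sqr_ge0.
  - by apply: ler_wpM2l => //; rewrite lef_pV2 ?posrE.
  - exact: (profile_first_moment_le m_gt0 degree_le (ltW r_gt0) phibar_ground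
      well0 well_peak).
by rewrite mulrAC; apply: ler_wpM2l.
Qed.

Lemma fixed_scale_eigenvector :
  l2box RR (fun x => phi x - phibar (x - x0)) <=
  eigenvector_const * eps * Num.sqrt error.
Proof.
have := translate_eigenvector_le m_gt0 degree_le r_gt0 x0_inner phi_ground
  phibar_ground xi_peak well0 well_peak.
rewrite -ler_pdivlMl// => /le_trans; apply.
have -> : eigenvector_const * eps * Num.sqrt error =
    m^-1 * (4 * (Num.sqrt residual_const * Num.sqrt error)).
  rewrite /eigenvector_const /m.
  move: (Num.sqrt residual_const) (Num.sqrt error) => sc se.
  by field; rewrite !gt_eqF.
rewrite -sqrtrM ?residual_const_ge0// ler_pM2l ?invr_gt0// ler_pM2l//.
exact: ler_wsqrtr residual_bound_le.
Qed.

Let sum_mismatchE :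
  \sum_(y <- box d r) mismatch xi well x0 y * phibar y ^+ 2 =
  \sum_(y <- box d r | y != 0) phibar y ^+ 2 * noise y -
  deviation * \sum_(y <- box d r | y != 0) (1 - v y) * phibar y ^+ 2.
Proof.
rewrite (bigD1_seq 0)/= ?mem_box ?inbox0 ?box_uniq ?(ltW r_gt0)//.
rewrite mismatch0 mul0r add0r mulr_sumr -sumrB.
by apply: eq_bigr => y _; rewrite mismatchE; ring.
Qed.

Lemma fixed_scale_eigenvalue :
  `|lam - lbar -
    (xi x0 + \sum_(y <- box d r | y != 0) phibar y ^+ 2 * noise y)| <=
  eigenvalue_const * eps * error.
Proof.
have := translate_eigenvalue_le m_gt0 degree_le r_gt0 x0_inner phi_ground
  phibar_ground xi_peak well0 well_peak.
rewrite sum_mismatchE; set first_order := \sum_(y <- _ | _) phibar y ^+ 2 * _.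
set depth := \sum_(y <- _ | _) _; set remainder := lam - _ - _ - _.
rewrite -ler_pdivlMl// => remainder_le.
have -> : lam - lbar - (xi x0 + first_order) = remainder - deviation * depth.
  by rewrite /remainder; ring.
rewrite -[leRHS]mulrA [leRHS]mulrDl.
apply: le_trans (ler_normB _ _) (lerD _ _).
  apply: le_trans remainder_le _.
  have -> : 12 / c * residual_const * (eps * error) =
      m^-1 * (6 * (residual_const * error)).
    by rewrite /m; move: residual_const error => rc e; field; rewrite !gt_eqF.
  by rewrite ler_pM2l ?invr_gt0// ler_pM2l// residual_bound_le.
have depth_ge0 : 0 <= depth.
  by apply: sumr_ge0 => y _; rewrite mulr_ge0 ?sqr_ge0.
rewrite normrM (ger0_norm depth_ge0) -mulrA.
apply: ler_pM => //; apply: le_trans sum_one_sub_v_le _.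
apply: ler_wpM2l; first by rewrite !mulr_ge0.
by rewrite ler_pM2l.
Qed.

End fixed_scale.

Section zeta_bound.
Context {R : realType} {dT : measure_display} {T : measurableType dT} {d : nat}.
Variables (P : probability T R) (xi : Zpt d -> T -> R) (v : Zpt d -> R).
Hypotheses (xi_gaussian : gaussian_field P xi v) (v0 : v 0 = 1).
Implicit Types (x y : Zpt d) (w : T).

Lemma measurable_zeta x0 x : measurable_fun setT (zeta xi v x0 x).
Proof.
case: xi_gaussian => mxi _.
by apply: measurable_funB => //; exact: measurable_funM.
Qed.

Lemma zeta_law x0 x A : measurable A ->
  P (zeta xi v x0 x @^-1` A) =
  centred_gaussian_law (1 - v (x - x0) * v (x0 - x)) A.
Proof.
move=> mA; pose s := [:: (x, 1); (x0, - v (x - x0))].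
have [_ /(_ s A mA)] := xi_gaussian.
rewrite !big_cons !big_nil/= !subrr v0.
have -> : (fun w => \sum_(p <- s) p.2 * xi p.1 w) = zeta xi v x0 x.
  by apply/funext => w; rewrite !big_cons big_nil/= /zeta; ring.
by move=> ->; congr centred_gaussian_law; ring.
Qed.

Lemma variance_zeta x0 x : v (x - x0) * v (x0 - x) < 1 ->
  fine 'V_P[zeta xi v x0 x] = 1 - v (x - x0) * v (x0 - x).
Proof.
rewrite -subr_gt0 => vv.
by rewrite (variance_gaussian (measurable_zeta x0 x) vv (@zeta_law x0 x)).
Qed.

Variables (D c c' : R).
Hypotheses (D_gt0 : 0 < D) (c_gt0 : 0 < c) (c'_ge0 : 0 <= c').
Hypothesis v_ge0 : forall y, 0 <= v y.
Hypothesis v_bounds : forall y, y != 0 ->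
  1 - expR (c' * enorm y) / D <= v y <= 1 - c / D.

Lemma one_sub_v_le y : y != 0 -> 1 - v y <= expR c' ^+ l1norm y / D.
Proof.
move=> y0; have /andP[v_lower _] := v_bounds y0.
apply: (@le_trans _ _ (expR (c' * enorm y) / D)); first by lra.
apply: ler_wpM2r; first by rewrite invr_ge0 ltW.
by rewrite -expRM_natr ler_expR ler_wpM2l// enorm_le_l1norm.
Qed.

Lemma variance_zeta_bounds x0 x : x != x0 ->
  0 < fine 'V_P[zeta xi v x0 x] <= 2 / D * expR c' ^+ l1norm (x - x0).
Proof.
move=> xx0; have y0 : x - x0 != 0 by rewrite subr_eq0.
have Ny0 : x0 - x != 0 by rewrite subr_eq0 eq_sym.
have cD : 0 < c / D by rewrite divr_gt0.
have [/andP[_ u1] /andP[_ u2]] := (v_bounds y0, v_bounds Ny0).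
have lower := one_sub_v_le y0; have lowerN := one_sub_v_le Ny0.
rewrite -[x0 - x]opprB l1normN opprB in lowerN.
have ge0 := v_ge0 (x - x0); have geN0 := v_ge0 (x0 - x).
have vv : v (x - x0) * v (x0 - x) < 1 by nra.
by rewrite variance_zeta// subr_gt0 vv/= [2 / D * _]mulrAC -[leRHS]mulrA; nra.
Qed.

Lemma sqr_zeta_le (a kappa : R) x0 x w : D <= a -> 0 < kappa -> x != x0 ->
  `|zeta xi v x0 x w| / Num.sqrt (fine ('V_P[zeta xi v x0 x])%E)
     <= (a / D) `^ (kappa * enorm (x - x0)) *
        Num.sqrt (Num.max 1 (`|xi x0 w - a| * a)) ->
  zeta xi v x0 x w ^+ 2 <= 2 / D * (1 + `|xi x0 w - a| * a) *
    (expR c' * (a / D) `^ (2 * kappa)) ^+ l1norm (x - x0).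
Proof.
move=> Da kappa0 xx0; have a0 := lt_le_trans D_gt0 Da.
have /andP[V_gt0 V_le] := variance_zeta_bounds xx0.
set V := fine _ in V_gt0 V_le *; set k := l1norm _ in V_le *.
set M := Num.max _ _; set g := (a / D) `^ (kappa * _).
set G := (a / D) `^ (2 * kappa); set dev := `|_| * a in M *.
rewrite ler_pdivrMr ?sqrtr_gt0// => zeta_le.
have dev0 : 0 <= dev by rewrite mulr_ge0// ltW.
have M_ge0 : 0 <= M by rewrite /M le_max ler01.
have M_le : M <= 1 + dev by rewrite /M ge_max lerDl lerDr ler01 dev0.
have g_le : g ^+ 2 <= G ^+ k.
  have aD1 : 1 <= a / D by rewrite ler_pdivlMr// mul1r.
  rewrite -(powR_mulrn 2 (powR_ge0 _ _)) -(powR_mulrn k (powR_ge0 _ _)).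
  rewrite -!powRrM; apply: ler_powR => //.
  by have := ler_wpM2l (ltW kappa0) (@enorm_le_l1norm R d (x - x0)); lra.
have zeta_sqr : zeta xi v x0 x w ^+ 2 <= g ^+ 2 * M * V.
  rewrite -(real_normK (num_real (zeta _ _ _ _ _))).
  rewrite -(sqr_sqrtr M_ge0) -(sqr_sqrtr (ltW V_gt0)) -!exprMn.
  by apply: lerXn2r; rewrite ?nnegrE// !mulr_ge0 ?powR_ge0 ?sqrtr_ge0.
apply: le_trans zeta_sqr _.
have -> : 2 / D * (1 + dev) * (expR c' * G) ^+ k =
    G ^+ k * (1 + dev) * (2 / D * expR c' ^+ k) by rewrite exprMn; ring.
apply: ler_pM => //; last exact: ler_pM (sqr_ge0 _) M_ge0 g_le M_le.
  by rewrite mulr_ge0 ?sqr_ge0.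
exact: ltW.
Qed.

End zeta_bound.

Section event_estimates.
Context {R : realType} {dT : measure_display} {T : measurableType dT} {d : nat}.
Variables (P : probability T R) (xi : Zpt d -> T -> R) (v : Zpt d -> R).
Variables (a D r RR kappa c c' lbar : R) (phibar : Zpt d -> R).
Local Notation b := (expR c').

Definition estimate_const : R :=
  eigenvalue_const (d := d) c b + eigenvector_const (d := d) c b + 1.

Hypotheses (c_gt0 : 0 < c) (c'_ge0 : 0 <= c').

Let b_ge1 : 1 <= b. Proof. by rewrite -[leLHS]expR0 ler_expR. Qed.

Let eigenvalue_const0 : 0 <= eigenvalue_const (d := d) c b.
Proof. exact: eigenvalue_const_ge0. Qed.

Let eigenvector_const0 : 0 <= eigenvector_const (d := d) c b.
Proof. exact: eigenvector_const_ge0. Qed.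

Lemma estimate_const_gt0 : 0 < estimate_const.
Proof. by rewrite ltr_pwDr// addr_ge0. Qed.

Hypotheses (xi_gaussian : gaussian_field P xi v) (v0 : v 0 = 1).
Hypothesis v_ge0 : forall y, 0 <= v y.
Hypothesis v_bounds : forall y, y != 0 ->
  1 - expR (c' * enorm y) / D <= v y <= 1 - c / D.
Hypotheses (kappa_gt0 : 0 < kappa) (kappa_le : kappa <= 2^-1).
Hypotheses (D_ge1 : 1 <= D) (a_gt0 : 0 < a) (a_le_r : a <= r).
Hypothesis ratio_small : ratio_threshold (d := d) c b * (D / a) <= 1.
Hypothesis phibar_ground :
  principal_eigenpair r (fun y => - (a * (1 - v y))) lbar phibar.

Lemma event_estimates x0 w lam phi : inbox (RR - r) x0 ->
  Eevent P xi v a D RR kappa x0 w ->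
  principal_eigenpair RR (fun x => xi x w) lam phi ->
  `|lam - lbar - Xi xi v r phibar x0 w| <= estimate_const * (D / a) *
    ((D / a) `^ (1 - 2 * kappa) * `|xi x0 w - a| + a^-1) /\
  l2box RR (fun x => phi x - phibar (x - x0)) <= estimate_const * (D / a) *
    Num.sqrt ((D / a) `^ (1 - 2 * kappa) * `|xi x0 w - a| + a^-1).
Proof.
move=> x0_inner [/ltW deviation_le zeta_le zeta_normalized_le] phi_ground.
have D_gt0 : 0 < D := lt_le_trans ltr01 D_ge1.
have D_le_a : D <= a.
  have := ratio_le1 D_ge1 a_gt0 c_gt0 ratio_small.
  by rewrite ler_pdivrMr// mul1r.
have v_lower y : y != 0 -> 1 - v y <= b ^+ l1norm y / D :=
  one_sub_v_le D_gt0 c'_ge0 v_bounds (y := y).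
have v_upper y : y != 0 -> c / D <= 1 - v y by move=> /v_bounds/andP[_]; lra.
have noiseE y : noise v (xi ^~ w) x0 y = zeta xi v x0 (y + x0) w.
  by rewrite /zeta addrK.
have noise_le y : inbox (2 * RR) y ->
    `|noise v (xi ^~ w) x0 y| <= 10^-1 * (a * (1 - v y)).
  by have := zeta_le (y + x0); rewrite addrK noiseE.
have sqr_noise_le y : inbox r y -> y != 0 -> noise v (xi ^~ w) x0 y ^+ 2 <=
    2 / D * (1 + `|xi x0 w - a| * a) * (b * (a / D) `^ (2 * kappa)) ^+ l1norm y.
  move=> yr y0; have yx0 : y + x0 != x0 by rewrite -subr_eq0 addrK.
  have := sqr_zeta_le xi_gaussian v0 D_gt0 c_gt0 c'_ge0 v_ge0 v_bounds D_le_a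
    kappa_gt0 yx0 (zeta_normalized_le _ _ yx0).
  rewrite noiseE addrK; apply; exact: inbox_inner_margin x0_inner yr.
have error_ge0 : 0 <= (D / a) `^ (1 - 2 * kappa) * `|xi x0 w - a| + a^-1.
  by rewrite addr_ge0 ?mulr_ge0 ?powR_ge0 ?invr_ge0// ltW.
have ratio_ge0 : 0 <= D / a by rewrite divr_ge0// ltW.
split.
- rewrite /Xi /Phi; under eq_bigr do rewrite -noiseE.
  apply: le_trans (fixed_scale_eigenvalue D_ge1 a_gt0 a_le_r c_gt0 b_ge1
    kappa_le ratio_small v0 v_lower v_upper x0_inner phibar_ground phi_ground
    deviation_le noise_le sqr_noise_le) _.
  by rewrite !ler_wpM2r// /estimate_const; have := eigenvector_const0; lra.
- apply: le_trans (fixed_scale_eigenvector D_ge1 a_gt0 a_le_r c_gt0 b_ge1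
    kappa_le ratio_small v0 v_lower v_upper x0_inner phibar_ground phi_ground
    deviation_le noise_le sqr_noise_le) _.
  rewrite !ler_wpM2r ?sqrtr_ge0// /estimate_const.
  by have := eigenvalue_const0; lra.
Qed.

End event_estimates.

Section large_scales.
Context {R : realType} {d : nat}.

(* A negative [D] would make [v >= 1] off the origin, against the decay of
   [v]. *)
Lemma correlation_scale_ge1 (D c' radius : R) (v : Zpt d -> R) : (0 < d)%N ->
  D != 0 -> 0 <= c' -> (forall x, 0 <= v x) ->
  (forall x, x != 0 -> 1 - expR (c' * enorm x) / D <= v x) ->
  (forall x, radius <= enorm x -> v x * ln (enorm x) <= 2^-1) ->
  (exists x, v x = 1 - D^-1) -> 1 <= D.
Proof.
move=> d_gt0 D_neq0 c'_ge0 v_ge0 v_lower v_decay [x vx].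
suff D_gt0 : 0 < D by have := v_ge0 x; rewrite vx subr_ge0 invf_le1.
rewrite lt_neqAle eq_sym D_neq0/= leNgt; apply/negP => D_lt0.
pose N := Num.bound (Num.max radius (expR 1)).
have : Num.max radius (expR 1) <= N%:R.
  by apply/ltW/archi_boundP; rewrite le_max expR_ge0 orbT.
rewrite ge_max => /andP[radius_le e_le].
pose far := unitv (Ordinal d_gt0) *+ N.
have farE : enorm far = N%:R :> R := enorm_unitv_mulrn _ _.
have N_gt0 : 0 < N%:R :> R := lt_le_trans (expR_gt0 1) e_le.
have far_neq0 : far != 0.
  rewrite -l1norm_gt0 -(ltr_nat R); apply: lt_le_trans (enorm_le_l1norm _).
  by rewrite farE.
have v_far : 1 <= v far.
  apply: le_trans (v_lower _ far_neq0); rewrite lerBrDr gerDl.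
  by rewrite mulr_ge0_le0 ?expR_ge0// invr_le0 ltW.
have ln_far : 1 <= ln (N%:R : R).
  by rewrite -[leLHS](expRK 1) ler_ln// posrE expR_gt0.
by have := v_decay far; rewrite farE => /(_ radius_le); nra.
Qed.

Lemma negl_lt (u w : nat -> R) (e : R) : negl u w -> 0 < e ->
  \forall L \near \oo, u L / w L < e.
Proof.
move=> [_ /cvgrPdist_lt uw] e0; apply: filterS (uw _ e0) => L.
by rewrite sub0r normrN; apply: le_lt_trans; exact: ler_norm.
Qed.

(* The hypothesis excludes [y <= 0], where [ln y = 0] by convention. *)
Lemma le_of_ler_ln (x y : R) : 1 < x -> ln x <= ln y -> x <= y.
Proof.
move=> x1 xy; have y0 : 0 < y.
  rewrite ltNge; apply/negP => /ln0 y0; move: xy.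
  by rewrite y0 leNgt ln_gt0.
by move: xy; rewrite ler_ln ?posrE// (lt_trans _ x1).
Qed.

Lemma near_scale_bounds (v : nat -> Zpt d -> R) (dL a rL : nat -> R)
    (t c' : R) :
  (0 < d)%N -> 0 < t -> 0 <= c' -> (forall L x, 0 <= v L x) ->
  (forall e : R, 0 < e -> exists L1 : nat, forall L : nat, (L1 <= L)%N ->
     forall x : Zpt d, expR (Num.sqrt (ln (L%:R : R))) <= enorm x ->
       v L x * ln (enorm x) <= e) ->
  (forall L, exists x, v L x = 1 - (dL L)^-1) ->
  (forall L x, x != 0 -> 1 - expR (c' * enorm x) / dL L <= v L x) ->
  (forall L : nat, (2 <= L)%N -> ln (a L) <= ln (rL L)) ->
  (\forall L \near \oo, dL L != 0) -> (\forall L \near \oo, 0 < a L) ->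
  negl dL a ->
  \forall L \near \oo,
    [/\ 1 <= dL L, 0 < a L, a L <= rL L & t * (dL L / a L) <= 1].
Proof.
move=> d_gt0 t_gt0 c'_ge0 v_ge0 v_decay unit_step v_lower ln_le dL_neq0 a_gt0.
move=> dL_negl.
have [L1 v_decay_L1] := v_decay 2^-1 ltac:(by rewrite invr_gt0).
have ratio_lt e : 0 < e -> \forall L \near \oo, dL L / a L < e :=
  negl_lt dL_negl.
near=> L.
have dL_ge1 : 1 <= dL L.
  apply: (correlation_scale_ge1 d_gt0 _ c'_ge0 (v_ge0 L) (v_lower L) _
    (unit_step L)); first by near: L.
  by apply: v_decay_L1; near: L; exact: nbhs_infty_ge.
have a_L_gt0 : 0 < a L by near: L.
split => //.
- apply: le_of_ler_ln; last by apply: ln_le; near: L; exact: nbhs_infty_ge.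
  have : dL L / a L < 1 by near: L; exact: ratio_lt.
  by rewrite ltr_pdivrMr// mul1r; exact: le_lt_trans.
- rewrite mulrC -ler_pdivlMr// mul1r; apply/ltW; near: L.
  by apply: ratio_lt; rewrite invr_gt0.
Unshelve. all: by end_near. Qed.

End large_scales.

Theorem theorem4p2 (R : realType) (d : nat) (kappa : R)
    (dT : measure_display) (T : measurableType dT)
    (P : nat -> probability T R)
    (xi : nat -> Zpt d -> T -> R) (v : nat -> Zpt d -> R)
    (dL a RL rL lbar : nat -> R) (phibar : nat -> Zpt d -> R) :
  (0 < d)%N ->
  0 < kappa < 3^-1 ->
  (* centred stationary Gaussian field, unit variance, non-negative covariance v_L *)
  (forall L, gaussian_field (P L) (xi L) (v L)) ->
  (forall L, v L 0 = 1) ->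
  (forall L x, 0 <= v L x) ->
  (* (I) *)
  (forall e : R, 0 < e -> exists L1 : nat, forall L : nat, (L1 <= L)%N ->
     forall x : Zpt d, expR (Num.sqrt (ln (L%:R : R))) <= enorm x ->
       v L x * ln (enorm x) <= e) ->
  (* d_L : sup_{|x|=1} v_L(x) = 1 - 1/d_L *)
  (forall L, (forall x : Zpt d, enorm x = 1 :> R -> v L x <= 1 - (dL L)^-1) /\
             (exists x : Zpt d, enorm x = 1 :> R /\ v L x = 1 - (dL L)^-1)) ->
  (* (II) *)
  (exists c c' : R, 0 < c /\ 0 < c' /\
     forall L (x : Zpt d), x != 0 ->
       1 - expR (c' * enorm x) / dL L <= v L x <= 1 - c / dL L) ->
  (* a_L : P(xi_L(0) > a_L) = L^{-d} *)
  (forall L : nat, (2 <= L)%N ->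
     P L [set w | a L < xi L 0 w] = ((L%:R : R) ^- d)%:E) ->
  (* scales R_L, r_L *)
  negl a (fun L => ln (RL L)) ->
  negl (fun L => ln (RL L)) (fun L => a L ^+ 2 / dL L) ->
  (forall L : nat, (2 <= L)%N -> ln (a L) <= ln (rL L)) ->
  negl (fun L => ln (rL L)) (fun L => Num.sqrt (a L)) ->
  (* principal eigenpair of Delta - S_L on Q_{r_L}, S_L = a_L (1 - v_L) *)
  (forall L, principal_eigenpair (rL L) (fun x => - (a L * (1 - v L x)))
                                 (lbar L) (phibar L)) ->
  (* standing assumptions: d_L << a_L, tau_L << a_L^{-1} (a_L/d_L)^{1/2} *)
  negl dL a ->
  negl (fun L => Num.sqrt (fine ('V_(P L)[Phi (xi L) (v L) (rL L) (phibar L) 0%R])%E))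
       (fun L => (a L)^-1 * Num.sqrt (a L / dL L)) ->
  exists C : R, 0 < C /\
  exists L0 : nat, (1 <= L0)%N /\
  forall L : nat, (L0 <= L)%N ->
  forall x0 : Zpt d, inbox (RL L - rL L) x0 ->
  forall w : T, Eevent (P L) (xi L) (v L) (a L) (dL L) (RL L) kappa x0 w ->
  forall (lam : R) (phi : Zpt d -> R),
    principal_eigenpair (RL L) (fun x => xi L x w) lam phi ->
    `|lam - lbar L - Xi (xi L) (v L) (rL L) (phibar L) x0 w|
      <= C * (dL L / a L) *
         ((dL L / a L) `^ (1 - 2 * kappa) * `|xi L x0 w - a L| + (a L)^-1)
    /\
    l2box (RL L) (fun x => phi x - phibar L (x - x0))
      <= C * (dL L / a L) *
         Num.sqrt ((dL L / a L) `^ (1 - 2 * kappa) * `|xi L x0 w - a L| + (a L)^-1).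
Proof.
move=> d_gt0 /andP[kappa_gt0 kappa_lt] xi_gaussian v0 v_ge0 v_decay dL_def
  [c [c' [c_gt0 [/ltW c'_ge0 v_bounds]]]] _ _ [sqr_a_neq0 _] ln_le
  [sqrt_a_neq0 _] phibar_ground dL_negl _.
exists (estimate_const (d := d) c c'); split; first exact: estimate_const_gt0.
have [L0 _ scales] : \forall L \near \oo,
    [/\ 1 <= dL L, 0 < a L, a L <= rL L &
        ratio_threshold (d := d) c (expR c') * (dL L / a L) <= 1].
  apply: (near_scale_bounds d_gt0 _ c'_ge0 v_ge0 v_decay _ _ ln_le _ _ dL_negl).
  - exact: ratio_threshold_gt0.
  - by move=> L; have [_ [x [_ vx]]] := dL_def L; exists x.
  - by move=> L x /(v_bounds L)/andP[].
  - apply: filterS sqr_a_neq0 => L.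
    by apply: contraNneq => ->; rewrite invr0 mulr0.
  - by apply: filterS sqrt_a_neq0 => L; rewrite sqrtr_eq0 -ltNge.
exists L0.+1; split=> // L /ltnW/scales[dL_ge1 a_gt0 a_le_r ratio_small] x0
  x0_inner w E lam phi.
apply: (event_estimates c_gt0 c'_ge0 (xi_gaussian L) (v0 L)) E => //.
  exact: v_bounds.
by lra.
Qed.
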